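(* Let $G$ be a finite group. Then $\Lambda(G)$ is normal in $\mathrm{Aut}(\mathcal{D}(G))$ if and only if $G$ is a stem group. Therefore, $\mathrm{Aut}(\mathcal{D}(G))$ is the (internal) semidirect product $\Lambda(G)\rtimes K$ of the subgroup $\Lambda(G)$ by the subgroup $K=\mathrm{SpAut}_c(G)\ltimes\mathrm{Hom}(G,\widehat{G})$ if and only if $G$ is a stem group.
   Context: The base field $\mathbbm{k}$ is algebraically closed of characteristic zero. For a finite group $G$, $\mathbbm{k}^G$ is the linear dual of $\mathbbm{k}G$, with dual basis $\{e_g\}_{g\in G}$ and identity $\varepsilon=\sum_{g}e_g$; $\widehat{G}=\mathrm{Hom}(G,\mathbbm{k}^\times)$ is the group of group-like elements of $\mathbbm{k}^G$. The Drinfeld double $\mathcal{D}(G)$ is the Hopf algebra with basis $e_g\# h$ ($g,h\in G$), multiplication $(e_g\# g')(e_h\# h')=\delta_{g,\,g'hg'^{-1}}\,e_g\# g'h'$, unit $\varepsilon\# 1$, and coalgebra structure $(\mathbbm{k}^G)^{\mathrm{cop}}\otimes\mathbbm{k}G$. $\mathrm{Aut}(\mathcal{D}(G))$ is its group of Hopf algebra automorphisms. Every Hopf algebra endomorphism $\psi$ of $\mathcal{D}(G)$ is determined by its components $(p,u,r,v)$, where $u(a)=(\mathrm{id}\otimes\varepsilon)\psi(a\#1)\in\mathbbm{k}^G$, $p(a)=(\mathrm{ev}_1\otimes\mathrm{id})\psi(a\#1)\in\mathbbm{k}G$, $r(g)=(\mathrm{id}\otimes\varepsilon)\psi(\varepsilon\#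 g)\in\widehat{G}$, $v(g)=(\mathrm{ev}_1\otimes\mathrm{id})\psi(\varepsilon\# g)\in G$ for $a\in\mathbbm{k}^G$, $g\in G$ (here $\mathrm{ev}_1(f)=f(1)$ and $\varepsilon$ in the second tensor factor is the counit of $\mathbbm{k}G$); one has $\psi(a\# g)=u(a_{(1)})r(g)\# p(a_{(2)})v(g)$, with Sweedler notation in $(\mathbbm{k}^G)^{\mathrm{cop}}$. Trivial $p$ means $p(a)=a(1)1_G$; trivial $r$ means $r(g)=\varepsilon$ for all $g$. $\Lambda(G)$ is the subgroup of automorphisms with $u=\mathrm{id}$, $v=\mathrm{id}$ and $r$ trivial. $K$ is the subgroup of all automorphisms with $p$ trivial; it is the semidirect product of the subgroup $\mathrm{SpAut}_c(G)$, consisting of the maps $e_g\# h\mapsto e_{w(g)}\# v(h)$ with $w,v\in\mathrm{Aut}(G)$ and $w^{-1}v$ a central automorphism of $G$ (i.e. $w^{-1}v(g)g^{-1}\in Z(G)$ for all $g$), and the normal subgroup $\mathrm{Hom}(G,\widehat{G})$, consisting of the maps $e_g\# h\mapsto r(h)e_g\# h$. $G$ is a stem group if $Z(G)\leq G'$, where $G'$ is the derived subgroup. *)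

(* Defs.v *)
From HB Require Import structures.
From mathcomp Require Import all_boot all_order all_algebra all_fingroup.
From mathcomp Require Import all_solvable all_field.

Set Implicit Arguments.
Unset Strict Implicit.
Unset Printing Implicit Defensive.

Import GRing.Theory.
Local Open Scope ring_scope.

Section FreeVectorSpace.
Variables (k : fieldType) (B : finType).

Definition basis_vec (b : B) : {ffun B -> k^o} := [ffun x => (x == b)%:R].

Variables (V : vectType k) (F : B -> V).

Definition lin_ext_fun (x : {ffun B -> k^o}) : V := \sum_b (x b : k) *: F b.

Fact lin_ext_linear : linear lin_ext_fun.
Proof.
move=> a x y; rewrite /lin_ext_fun scaler_sumr -big_split /=.
by apply: eq_bigr => b _; rewrite !ffunE scalerDl scalerA.
Qed.

HB.instance Definition _ :=
  GRing.isLinear.Build k {ffun B -> k^o} V _ lin_ext_fun lin_ext_linear.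

(* The linear map sending the basis vector b to F b.                          *)
Definition lin_ext : 'Hom({ffun B -> k^o}, V) := linfun lin_ext_fun.

Lemma lin_extE x : lin_ext x = \sum_b (x b : k) *: F b.
Proof. by rewrite lfunE. Qed.

Lemma lin_ext_basis b : lin_ext (basis_vec b) = F b.
Proof.
rewrite lin_extE (bigD1 b) //= big1 ?addr0 => [|c /negPf cb]; rewrite ffunE.
  by rewrite eqxx scale1r.
by rewrite cb scale0r.
Qed.

End FreeVectorSpace.

Arguments basis_vec {k B}.
Arguments lin_ext {k B V}.

Lemma ffun_basis (k : fieldType) (B : finType) (x : {ffun B -> k^o}) :
  x = \sum_b (x b : k) *: basis_vec b.
Proof.
apply/ffunP=> c; rewrite sum_ffunE (bigD1 c) //= big1 => [|b /negPf bc].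
  by rewrite !ffunE eqxx addr0; exact/esym/mulr1.
by rewrite !ffunE eq_sym bc; exact: mulr0.
Qed.

Section Tensor.
Variables (k : fieldType) (B C : finType).

(* The tensor product of {ffun B -> k^o} and {ffun C -> k^o} is realised as   *)
(* {ffun B * C -> k^o}; pure_tensor is the canonical bilinear map.            *)
Definition pure_tensor (x : {ffun B -> k^o}) (y : {ffun C -> k^o}) :
  {ffun B * C -> k^o} := [ffun bc => x bc.1 * y bc.2].

End Tensor.

Definition tensor_map (k : fieldType) (B : finType)
    (f : 'End({ffun B -> k^o})) : 'End({ffun B * B -> k^o}) :=
  lin_ext (fun bc : B * B =>
    pure_tensor (f (basis_vec bc.1)) (f (basis_vec bc.2))).

Section TensorMap.
Variables (k : fieldType) (B : finType).
Implicit Types f g : 'End({ffun B -> k^o}).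

Lemma tensor_map_pure f x y :
  tensor_map f (pure_tensor x y) = pure_tensor (f x) (f y).
Proof.
have fE z i : f z i = \sum_b (z b : k) * (f (basis_vec b) i : k).
  rewrite {1}(ffun_basis z) linear_sum sum_ffunE.
  by apply: eq_bigr => b _; rewrite linearZ ffunE.
apply/ffunP=> -[i j]; rewrite lin_extE sum_ffunE ffunE /= !fE mulr_suml.
under [RHS]eq_bigr do rewrite mulr_sumr.
rewrite pair_bigA /=; apply: eq_bigr => -[b c] _.
by rewrite !ffunE /=; exact: mulrACA.
Qed.

Lemma basis_vec_pair (b c : B) :
  basis_vec (b, c) = pure_tensor (basis_vec b) (basis_vec c)
    :> {ffun B * B -> k^o}.
Proof.
apply/ffunP=> -[i j]; rewrite !ffunE /= xpair_eqE.
by case: eqP => _ /=; rewrite ?mul0r ?mul1r.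
Qed.

Lemma lfun_basis_eq (V : vectType k) (f g : 'Hom({ffun B -> k^o}, V)) :
  (forall b, f (basis_vec b) = g (basis_vec b)) -> f = g.
Proof.
move=> fg; apply/lfunP=> x; rewrite (ffun_basis x) !linear_sum.
by apply: eq_bigr => b _; rewrite !linearZ_LR; congr (_ *: _); exact: fg.
Qed.

End TensorMap.

Lemma tensor_map_id (k : fieldType) (B : finType) :
  tensor_map \1%VF = \1%VF :> 'End({ffun B * B -> k^o}).
Proof.
apply: lfun_basis_eq => -[b c].
by rewrite basis_vec_pair tensor_map_pure !id_lfunE.
Qed.

Lemma tensor_map_comp (k : fieldType) (B : finType)
    (f g : 'End({ffun B -> k^o})) :
  tensor_map (f \o g)%VF = (tensor_map f \o tensor_map g)%VF.
Proof.
apply: lfun_basis_eq => -[b c].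
by rewrite basis_vec_pair comp_lfunE !tensor_map_pure !comp_lfunE.
Qed.

Section DrinfeldDouble.
Variables (k : fieldType) (gT : finGroupType).
Implicit Types g h : gT.

Definition drinfeld_double : predArgType := {ffun gT * gT -> k^o}.

HB.instance Definition _ := Vector.copy drinfeld_double {ffun gT * gT -> k^o}.

Definition dd g h : drinfeld_double := basis_vec (g, h).

Definition dd_mul_basis (b c : gT * gT) : drinfeld_double :=
  if b.1 == (b.2 * c.1 * b.2^-1)%g then dd b.1 (b.2 * c.2)%g else 0.

Definition dd_mul (x y : drinfeld_double) : drinfeld_double :=
  \sum_b \sum_c ((x b : k) * (y c : k)) *: dd_mul_basis b c.

Definition dd_one : drinfeld_double := \sum_g dd g 1%g.

Lemma dd_mulE (x y : drinfeld_double) g t :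
  dd_mul x y (g, t) =
    \sum_s (x (g, s) : k) * (y ((s^-1 * g * s)%g, (s^-1 * t)%g) : k).
Proof.
have inner b : (\sum_c ((x b : k) * (y c : k)) *: dd_mul_basis b c) (g, t) =
    if b.1 == g then
      (x b : k) * (y ((b.2^-1 * g * b.2)%g, (b.2^-1 * t)%g) : k) else 0 :> k.
  rewrite sum_ffunE; case: b => a s /=.
  rewrite (bigD1 (s^-1 * g * s, s^-1 * t)%g) //= big1 ?addr0.
    rewrite ffunE /dd_mul_basis /= !mulgA !mulgV !mul1g mulgK.
    case: eqP => [->|_]; last by rewrite ffunE scaler0.
    by rewrite ffunE eqxx; exact: mulr1.
  move=> [c1 c2] /negPf nc; rewrite ffunE /dd_mul_basis /=.
  case: eqP => [e|_]; last by rewrite ffunE scaler0.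
  rewrite ffunE; case: eqP => [[ga tE]|_]; last exact: mulr0.
  by rewrite ga tE e !mulgA mulVg mul1g mulgKV mul1g eqxx in nc.
rewrite /dd_mul sum_ffunE (eq_bigr _ (fun b _ => inner b)) -big_mkcond /=.
rewrite (reindex_onto (fun s => (g, s)) snd) /=; last first.
  by move=> [a s] /eqP /= ->.
by apply: eq_big => [s|s _] //=; rewrite !eqxx.
Qed.

Fact dd_mulA : associative dd_mul.
Proof.
move=> x y z; apply/ffunP=> -[g t]; rewrite !dd_mulE.
transitivity (\sum_s \sum_u (x (g, s) : k) *
    ((y ((s^-1 * g * s)%g, (s^-1 * u)%g) : k) *
     (z ((u^-1 * g * u)%g, (u^-1 * t)%g) : k))).
  apply: eq_bigr => s _; rewrite dd_mulE mulr_sumr.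
  rewrite (reindex_inj (mulgI s^-1%g)) /=; apply: eq_bigr => u _.
  by rewrite !invMg !invgK !mulgA !mulgK.
rewrite exchange_big /=; apply: eq_bigr => u _; rewrite dd_mulE mulr_suml.
by apply: eq_bigr => s _; rewrite mulrA.
Qed.

Lemma dd_oneE g t : dd_one (g, t) = (t == 1%g)%:R.
Proof.
rewrite /dd_one sum_ffunE (bigD1 g) //= big1 ?addr0 => [|h /negPf gh].
  by rewrite ffunE xpair_eqE eqxx.
by rewrite ffunE xpair_eqE eq_sym gh.
Qed.

Fact dd_mul1r : left_id dd_one dd_mul.
Proof.
move=> x; apply/ffunP=> -[g t]; rewrite dd_mulE (bigD1 1%g) //= big1.
  by rewrite dd_oneE eqxx invg1 !mul1g mulg1 mul1r addr0.
by move=> s /negPf s1; rewrite dd_oneE s1 mul0r.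
Qed.

Fact dd_mulr1 : right_id dd_one dd_mul.
Proof.
move=> x; apply/ffunP=> -[g t]; rewrite dd_mulE (bigD1 t) //= big1.
  by rewrite dd_oneE mulVg eqxx mulr1 addr0.
move=> s /negPf st; rewrite dd_oneE -eq_mulVg1 st; exact: mulr0.
Qed.

Fact dd_mulDl : left_distributive dd_mul +%R.
Proof.
move=> x y z; apply/ffunP=> -[g t]; rewrite [RHS]ffunE !dd_mulE -big_split.
by apply: eq_bigr => s _; rewrite ffunE mulrDl.
Qed.

Fact dd_mulDr : right_distributive dd_mul +%R.
Proof.
move=> x y z; apply/ffunP=> -[g t]; rewrite [RHS]ffunE !dd_mulE -big_split.
by apply: eq_bigr => s _; rewrite ffunE mulrDr.
Qed.

Fact dd_one_neq0 : dd_one != 0.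
Proof.
apply/eqP=> /ffunP/(_ (1, 1)%g)/eqP.
by rewrite dd_oneE eqxx ffunE oner_eq0.
Qed.

HB.instance Definition _ := GRing.Zmodule_isNzRing.Build drinfeld_double
  dd_mulA dd_mul1r dd_mulr1 dd_mulDl dd_mulDr dd_one_neq0.

Lemma dd_mul_dd g g' h h' :
  dd g g' * dd h h' =
    if g == (g' * h * g'^-1)%g then dd g (g' * h')%g else 0.
Proof.
rewrite [LHS]/(dd_mul _ _) /dd_mul (bigD1 (g, g')) //= [X in _ + X]big1.
  rewrite addr0 (bigD1 (h, h')) //= [X in _ + X]big1.
    by rewrite !ffunE !eqxx mulr1 scale1r addr0.
  by move=> b /negPf bh; rewrite !ffunE bh mulr0 scale0r.
move=> b /negPf bg; apply: big1 => c _.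
by rewrite !ffunE bg mul0r scale0r.
Qed.

Fact dd_scalerAl (a : k) (x y : drinfeld_double) : a *: (x * y) = (a *: x) * y.
Proof.
apply/ffunP=> -[g t]; rewrite ffunE [_ * _]/(dd_mul _ _) [_ * y]/(dd_mul _ _).
rewrite !dd_mulE [LHS]mulr_sumr.
by apply: eq_bigr => s _; rewrite ffunE; exact: mulrA.
Qed.

HB.instance Definition _ :=
  GRing.Lmodule_isLalgebra.Build k drinfeld_double dd_scalerAl.

Fact dd_scalerAr (a : k) (x y : drinfeld_double) : a *: (x * y) = x * (a *: y).
Proof.
apply/ffunP=> -[g t]; rewrite ffunE [x * y]/(dd_mul _ _) [x * _]/(dd_mul _ _).
rewrite !dd_mulE [LHS]mulr_sumr.
by apply: eq_bigr => s _; rewrite ffunE; exact: mulrCA.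
Qed.

HB.instance Definition _ :=
  GRing.Lalgebra_isAlgebra.Build k drinfeld_double dd_scalerAr.

HB.instance Definition _ := Algebra_isFalgebra.Build k drinfeld_double.

(* In (k^G)^cop the coproduct of e_g is the sum of e_b (x) e_a over ab = g.   *)
Definition dd_comul :
    'Hom(drinfeld_double, {ffun (gT * gT) * (gT * gT) -> k^o}) :=
  lin_ext (fun b : gT * gT =>
    \sum_a basis_vec (((a^-1 * b.1)%g, b.2), (a, b.2))).

Definition dd_counit : 'Hom(drinfeld_double, k^o) :=
  lin_ext (fun b : gT * gT => (b.1 == 1%g)%:R).

(* S(e_g # h) = S(epsilon # h) S(e_g # 1) = (epsilon # h^-1) (e_(g^-1) # 1),  *)
(* which is e_(h^-1 g^-1 h) # h^-1.                                            *)
Definition dd_antipode : 'End(drinfeld_double) :=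
  lin_ext (fun b : gT * gT => dd (b.2^-1 * b.1^-1 * b.2)%g b.2^-1%g).

(* The elements of 'AEnd(drinfeld_double) are the unital algebra endomorphisms.*)
Definition is_hopf_aut (f : 'AEnd(drinfeld_double)) : bool :=
  [&& lker f == 0%VS,
      (dd_comul \o f == tensor_map f \o dd_comul)%VF,
      (dd_counit \o f == dd_counit)%VF &
      (dd_antipode \o f == f \o dd_antipode)%VF].

Structure hopf_aut :=
  HopfAut {hopf_aut_val :> 'AEnd(drinfeld_double); _ : is_hopf_aut hopf_aut_val}.

HB.instance Definition _ := [isSub for hopf_aut_val].
HB.instance Definition _ := [Equality of hopf_aut by <:].
HB.instance Definition _ := [Choice of hopf_aut by <:].

Fact id_is_hopf_aut : is_hopf_aut \1%AF.
Proof.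
apply/and4P; split.
- by apply/lker0P=> x y; rewrite !id_lfunE.
- by rewrite tensor_map_id comp_lfun1l comp_lfun1r.
- by rewrite comp_lfun1r.
- by rewrite comp_lfun1l comp_lfun1r.
Qed.

Fact comp_is_hopf_aut (f g : hopf_aut) : is_hopf_aut (f \o g)%AF.
Proof.
case: f g => [f fH] [g gH] /=.
have /and4P[f0 /eqP fD /eqP fe /eqP fS] := fH.
have /and4P[g0 /eqP gD /eqP ge /eqP gS] := gH; apply/and4P; split => /=.
- by apply/lker0P=> x y; rewrite !comp_lfunE => /(lker0P f0)/(lker0P g0).
- by rewrite comp_lfunA fD -comp_lfunA gD comp_lfunA tensor_map_comp.
- by rewrite comp_lfunA fe ge.
- by apply/eqP; rewrite comp_lfunA fS -[LHS]comp_lfunA gS comp_lfunA.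
Qed.

Fact inv_is_ahom (f : hopf_aut) : ahom_in {:drinfeld_double} f^-1%VF.
Proof.
case: f => [f fH] /=; have /and4P[f0 _ _ _] := fH.
have fK := lker0_lfunVK f0.
by apply/ahom_inP; split=> [x y _ _|]; apply: (lker0P f0);
  rewrite ?rmorphM ?rmorph1 /= !fK.
Qed.

Fact inv_is_hopf_aut (f : hopf_aut) : is_hopf_aut (AHom (inv_is_ahom f)).
Proof.
move: (inv_is_ahom f); case: f => [f fH] /= fA.
have /and4P[f0 /eqP fD /eqP fe /eqP fS] := fH.
have fK := lker0_compfV f0; apply/and4P; split => /=.
- by apply/lker0P=> x y /(congr1 f); rewrite !lker0_lfunVK.
- apply/eqP; rewrite -[RHS]comp_lfun1r -fK [in RHS]comp_lfunA.
  rewrite -(comp_lfunA _ dd_comul f) fD !comp_lfunA -tensor_map_comp.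
  by rewrite lker0_compVf // tensor_map_id comp_lfun1l.
- by rewrite -{1}fe -comp_lfunA fK comp_lfun1r.
- apply/eqP; rewrite -[RHS]comp_lfun1r -fK [in RHS]comp_lfunA.
  rewrite -(comp_lfunA _ dd_antipode f) fS !comp_lfunA.
  by rewrite lker0_compVf // comp_lfun1l.
Qed.

Definition hopf_aut_one := HopfAut id_is_hopf_aut.
Definition hopf_aut_mul (f g : hopf_aut) := HopfAut (comp_is_hopf_aut f g).
Definition hopf_aut_inv f := HopfAut (inv_is_hopf_aut f).

Lemma hopf_aut_eq (f g : hopf_aut) : f = g :> 'End(drinfeld_double) -> f = g.
Proof. by move=> fg; do 2!apply: val_inj. Qed.

Fact hopf_aut_mulA : associative hopf_aut_mul.
Proof. by move=> f f' f''; apply: hopf_aut_eq; rewrite /= comp_lfunA. Qed.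
Fact hopf_aut_mul1 : left_id hopf_aut_one hopf_aut_mul.
Proof. by move=> f; apply: hopf_aut_eq; rewrite /= comp_lfun1l. Qed.
Fact hopf_aut_mulr1 : right_id hopf_aut_one hopf_aut_mul.
Proof. by move=> f; apply: hopf_aut_eq; rewrite /= comp_lfun1r. Qed.
Fact hopf_aut_mulV : left_inverse hopf_aut_one hopf_aut_inv hopf_aut_mul.
Proof.
move=> f; apply: hopf_aut_eq; case: f => [f fH] /=.
by apply: lker0_compVf; case/and4P: fH.
Qed.
Fact hopf_aut_mulrV : right_inverse hopf_aut_one hopf_aut_inv hopf_aut_mul.
Proof.
move=> f; apply: hopf_aut_eq; case: f => [f fH] /=.
by apply: lker0_compfV; case/and4P: fH.
Qed.

(* The product f * g in this group is the composite f \o g.                   *)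
HB.instance Definition _ := isGroup.Build hopf_aut
  hopf_aut_mulA hopf_aut_mul1 hopf_aut_mulr1 hopf_aut_mulV hopf_aut_mulrV.

(* a # x, for a in k^G = {ffun gT -> k^o} (whose ring structure is the        *)
(* pointwise one) and x in kG, whose basis elements are the basis_vec g.      *)
Definition smash (a x : {ffun gT -> k^o}) : drinfeld_double := pure_tensor a x.

Definition id_counit : 'Hom(drinfeld_double, {ffun gT -> k^o}) :=
  lin_ext (fun b : gT * gT => basis_vec b.1).

Definition ev1_id : 'Hom(drinfeld_double, {ffun gT -> k^o}) :=
  lin_ext (fun b : gT * gT => (basis_vec b.1 1%g : k) *: basis_vec b.2).

Section Components.
Variable psi : hopf_aut.

Definition comp_u (a : {ffun gT -> k^o}) : {ffun gT -> k^o} :=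
  id_counit (psi (smash a (basis_vec 1%g))).
Definition comp_p (a : {ffun gT -> k^o}) : {ffun gT -> k^o} :=
  ev1_id (psi (smash a (basis_vec 1%g))).
Definition comp_r g : {ffun gT -> k^o} :=
  id_counit (psi (smash 1 (basis_vec g))).
Definition comp_v g : {ffun gT -> k^o} :=
  ev1_id (psi (smash 1 (basis_vec g))).

Definition trivial_p : Prop :=
  forall a : {ffun gT -> k^o}, comp_p a = (a 1%g : k) *: basis_vec 1%g.

Definition trivial_r : Prop := forall g, comp_r g = 1.

Definition Lambda : Prop :=
  [/\ forall a, comp_u a = a, forall g, comp_v g = basis_vec g & trivial_r].

Definition K_aut : Prop := trivial_p.

Definition SpAut_c : Prop :=
  exists w v : {perm gT},
    [/\ w \in Aut [set: gT], v \in Aut [set: gT],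
        forall g, (w^-1%g (v g) * g^-1)%g \in 'Z([set: gT])%g
      & forall g h, psi (dd g h) = dd (w g) (v h)].

Definition linear_char (chi : {ffun gT -> k^o}) : Prop :=
  (forall g, chi g != 0) /\ (forall g h, chi (g * h)%g = chi g * chi h).

Definition Hom_G_Ghat : Prop :=
  exists r : gT -> {ffun gT -> k^o},
    [/\ forall h, linear_char (r h),
        forall h h', r (h * h')%g = r h * r h'
      & forall g h, psi (dd g h) = smash (r h * basis_vec g) (basis_vec h)].

End Components.

Definition stem_group : bool := 'Z([set: gT])%g \subset [set: gT]^`(1)%g.

End DrinfeldDouble.

Section Subgroups.
Variable T : groupType.
Implicit Types H K N : T -> Prop.
Local Open Scope group_scope.

Definition is_subgroup H : Prop :=
  H 1 /\ (forall x y, H x -> H y -> H (x * y^-1)).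

Definition is_normal N : Prop :=
  is_subgroup N /\ forall x y, N x -> N (x ^ y).

(* H is the internal semidirect product of its normal subgroup N by its       *)
(* subgroup K.                                                                *)
Definition internal_sdprod H N K : Prop :=
  [/\ is_subgroup N, is_subgroup K, forall x y, N x -> H y -> N (x ^ y),
      forall x, N x -> K x -> x = 1
    & forall x, H x <-> exists y z, [/\ N y, K z & x = y * z]].

End Subgroups.

(* Main.v *)
(* In coordinates, an automorphism psi of D(G) is a matrix, and               *)
(* comultiplicativity says that the functions g |-> (coefficient of s in      *)
(* p(e_g)) are orthogonal idempotents for convolution commuting with all the  *)
(* matrix coefficients of psi. As psi is bijective they are central, and      *)
(* since distinct p(e_g) are orthogonal, p is supported on Z(G); dually, its  *)
(* image lies in kZ(G). Hence u is dual to an endomorphism w of G and         *)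
(*   psi(e_g # h) = sum_(x, t) c(w(x)^-1 g, t v(h)^-1) r(h)(x) e_x # t,       *)
(* with G = w(G) Z(G) = v(G) Z(G).                                            *)
(* If G is a stem group, then Z(G) <= G' = v(G)' = w(G)' makes v and w        *)
(* bijective, and r is trivial on Z(G) in both arguments; thus                *)
(* psi |-> (u, v, r) is multiplicative with kernel Lambda(G), and each of its *)
(* values is attained on K.                                                   *)
(* If G is not a stem group, some cyclic quotient G / N does not kill a       *)
(* central c0. This yields r : G -> G^ with r(h)(c0) != 1 for some h;         *)
(* conjugating by r the element of Lambda(G) given by the Fourier transform   *)
(* of <c0> yields an automorphism whose component v is not trivial.           *)

Require Import Defs.
From HB Require Import structures.
From mathcomp Require Import all_boot all_order all_algebra all_fingroup.
From mathcomp Require Import all_solvable all_field all_character ring.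

Set Implicit Arguments.
Unset Strict Implicit.
Unset Printing Implicit Defensive.

Import GRing.Theory.
Local Open Scope ring_scope.

(** * Matrix coefficients *)

Section Coefficients.
Variables (k : fieldType) (gT : finGroupType).
Local Notation D := (drinfeld_double k gT).
Implicit Types (f : 'End(D)) (X Y : D) (g h x t s : gT).

(** The engine is [component_specP]: an automorphism is determined by a kernel [c] supported on Z(G)
    x Z(G), endomorphisms [w], [v] of G and a pairing [R] of G with itself. When two automorphisms
    are composed, their p-components influence the u, v, r of the product only through values of [R]
    with one argument central.

    If Z(G) <= G', these values are all 1, because characters kill G' ([stem_center_char]). Hence
    the triples (w, v, R) compose as if p were absent ([stem_spec_mul]). So Lambda(G), given by w =
    id, v = id and R = 1, is stable under conjugation ([stem_Lambda_normal]); and dividing psi by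
    the element of K with the same triple leaves an element of Lambda(G) ([stem_decomposition]). The
    elements of K are the automorphisms that permute the basis up to scalars ([K_aut_monomial]).

    If Z(G) is not contained in G', some central c0 pairs nontrivially with some h
    ([nonstem_pairing]). Let x in Lambda(G) come from the Fourier kernel of <c0> ([cyclic_kernel],
    [kernel_hopf_aut]), and y in Hom(G, G^) from the pairing. The coefficient of e_1 # h in (y^-1 x
    y)(epsilon # h) is the average over <c0> of a nontrivial character, that is 0, while it would be
    1 in Lambda(G) ([nonstem_Lambda_not_normal]). Since a semidirect product includes normality,
    both equivalences follow. *)

Definition dcoef X g h : k := X (g, h).

Definition coef f g h x t : k := dcoef (f (dd k g h)) x t.

Lemma dcoef_dd g h x t : dcoef (dd k g h) x t = ((x == g) && (t == h))%:R.
Proof. by rewrite /dcoef ffunE xpair_eqE. Qed.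

Lemma dcoef_sum (I : finType) (F : I -> D) x t :
  dcoef (\sum_i F i) x t = \sum_i dcoef (F i) x t.
Proof. by rewrite /dcoef sum_ffunE. Qed.

Lemma dcoefZ (a : k) X x t : dcoef (a *: X) x t = a * dcoef X x t.
Proof. by rewrite /dcoef ffunE. Qed.

Lemma dcoefP X Y : (forall x t, dcoef X x t = dcoef Y x t) -> X = Y.
Proof. by move=> XY; apply/ffunP=> -[x t]; exact: XY. Qed.

Lemma dd_decomp X : X = \sum_g \sum_h dcoef X g h *: dd k g h.
Proof.
rewrite pair_bigA /= [LHS](ffun_basis X).
by apply: eq_bigr => -[g h] _.
Qed.

Lemma dcoef_lfun f X x t :
  dcoef (f X) x t = \sum_g \sum_h dcoef X g h * coef f g h x t.
Proof.
rewrite {1}(dd_decomp X) linear_sum dcoef_sum; apply: eq_bigr => g _.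
rewrite linear_sum dcoef_sum; apply: eq_bigr => h _.
by rewrite linearZ_LR dcoefZ.
Qed.

Lemma lfun_coefP f1 f2 :
  (forall g h x t, coef f1 g h x t = coef f2 g h x t) -> f1 = f2.
Proof.
move=> e; apply/lfunP=> X; apply: dcoefP => x t.
rewrite !dcoef_lfun; apply: eq_bigr => g _; apply: eq_bigr => h _.
by rewrite e.
Qed.

Lemma dcoefM X Y g t :
  dcoef (X * Y) g t =
    \sum_s dcoef X g s * dcoef Y (s^-1 * g * s)%g (s^-1 * t)%g.
Proof. exact: dd_mulE. Qed.

Lemma dcoef1 g t : dcoef 1 g t = (t == 1%g)%:R.
Proof. exact: dd_oneE. Qed.

(** The product is x' * x, not x * x', because the coproduct of k^G is reversed. *)
Lemma comul_coef X x s x' s' :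
  dd_comul k gT X ((x, s), (x', s')) = (s == s')%:R * dcoef X (x' * x)%g s :> k.
Proof.
rewrite lin_extE sum_ffunE (bigD1 ((x' * x)%g, s)) //= [X in _ + X]big1 ?addr0.
  rewrite ffunE sum_ffunE (bigD1 x') //= big1 ?addr0 => [|a ax]; last first.
    by rewrite ffunE !xpair_eqE [x' == a]eq_sym (negPf ax) andbF.
  rewrite ffunE !xpair_eqE mulKg !eqxx /= [s' == s]eq_sym.
  by rewrite [LHS]mulrC.
case=> y u yu; rewrite ffunE sum_ffunE big1 ?scaler0 //= => a _.
rewrite ffunE !xpair_eqE; case: (x' =P a) => [xa|]; last by rewrite /= ?andbF.
case: (x =P _) => [xe|]; last by rewrite /= ?andbF.
case: (s =P u) => [su|]; last by rewrite /= ?andbF.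
by case/eqP: yu; rewrite xe xa su mulKVg.
Qed.

Lemma counit_coef X : dd_counit k gT X = \sum_s dcoef X 1%g s :> k.
Proof.
transitivity (\sum_g \sum_h (g == 1%g)%:R * dcoef X g h).
  rewrite pair_bigA lin_extE /=; apply: (@eq_bigr k 0 +%R) => -[g h] _ /=.
  exact: mulrC.
rewrite (bigD1 1%g) //= [X in _ + X]big1 ?addr0 => [|g /negPf g1].
  by apply: eq_bigr => h _; rewrite eqxx mul1r.
by apply: big1 => h _; rewrite g1 mul0r.
Qed.

Lemma dcoef_antipode X x s :
  dcoef (dd_antipode k gT X) x s = dcoef X (s^-1 * x^-1 * s)%g s^-1%g.
Proof.
rewrite /dcoef lin_extE sum_ffunE.
rewrite (bigD1 ((s^-1 * x^-1 * s)%g, s^-1%g)) //= big1 ?addr0.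
  rewrite ffunE [X in _ *: X]dcoef_dd !invMg !invgK !mulgA mulgV mul1g mulgK
    !eqxx /=.
  exact: mulr1.
case=> y u yu; rewrite ffunE [X in _ *: X]dcoef_dd /=.
case: (s =P _) => [su|]; last by rewrite /= ?andbF scaler0.
case: (x =P _) => [xu|]; last by rewrite /= ?andbF scaler0.
by case/eqP: yu; rewrite xu su !invMg !invgK !mulgA mulgV mul1g mulgK.
Qed.

End Coefficients.

(** * The Hopf algebra axioms as identities between matrix coefficients *)

Section HopfConditions.
Variables (k : fieldType) (gT : finGroupType).
Local Notation D := (drinfeld_double k gT).
Local Notation dd := (dd k).
Implicit Types (f : 'End(D)) (X Y : D) (g h x t s : gT).

Lemma comul_coefP f :
  (dd_comul k gT \o f = tensor_map f \o dd_comul k gT)%VF <->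
  (forall g h x s x' s', (s == s')%:R * coef f g h (x' * x)%g s =
     \sum_a coef f (a^-1 * g)%g h x s * coef f a h x' s').
Proof.
have R g h x s x' s' : tensor_map f (dd_comul k gT (dd g h)) ((x, s), (x', s'))
    = \sum_a coef f (a^-1 * g)%g h x s * coef f a h x' s' :> k.
  rewrite /dd_comul lin_ext_basis linear_sum sum_ffunE /=.
  apply: (@eq_bigr k 0 +%R) => a _.
  by rewrite basis_vec_pair tensor_map_pure ffunE.
split=> [e g h x s x' s'|e].
  by rewrite -R -comul_coef -[RHS]/(tensor_map f _ _) -!comp_lfunE e.
apply: lfun_basis_eq => -[g h]; apply/ffunP=> -[[x s] [x' s']].
by rewrite !comp_lfunE R comul_coef e.
Qed.

Lemma counit_coefP f :
  (dd_counit k gT \o f = dd_counit k gT)%VF <->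
  (forall g h, \sum_s coef f g h 1%g s = (g == 1%g)%:R).
Proof.
have R g h : dd_counit k gT (dd g h) = (g == 1%g)%:R :> k.
  by rewrite /dd_counit lin_ext_basis.
split=> [e g h|e]; first by rewrite -(R g h) -[in RHS]e comp_lfunE counit_coef.
by apply: lfun_basis_eq => -[g h]; rewrite comp_lfunE counit_coef R e.
Qed.

Lemma antipode_coefP f :
  (dd_antipode k gT \o f = f \o dd_antipode k gT)%VF <->
  (forall g h x s, coef f g h (s^-1 * x^-1 * s)%g s^-1%g =
     coef f (h^-1 * g^-1 * h)%g h^-1%g x s).
Proof.
have R g h : f (dd_antipode k gT (dd g h)) = f (dd (h^-1 * g^-1 * h)%g h^-1%g).
  by rewrite /dd_antipode lin_ext_basis.
split=> [e g h x s|e].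
  by rewrite /coef -R -dcoef_antipode -!comp_lfunE e.
apply: lfun_coefP => g h x s.
by rewrite /coef !comp_lfunE R dcoef_antipode; exact: e.
Qed.

Lemma ddM g h g' h' : dd g h * dd g' h' =
  (g == h * g' * h^-1)%g%:R *: dd g (h * h')%g.
Proof. by rewrite dd_mul_dd; case: eqP; rewrite ?scale1r ?scale0r. Qed.

Lemma ahom_coefP f :
  ahom_in {:D} f <->
  (forall g h g' h' x t,
     \sum_s coef f g h x s * coef f g' h' (s^-1 * x * s)%g (s^-1 * t)%g =
     (g == h * g' * h^-1)%g%:R * coef f g (h * h')%g x t) /\
  (forall x t, \sum_g coef f g 1%g x t = (t == 1%g)%:R).
Proof.
have R x t : dcoef (f 1) x t = \sum_g coef f g 1%g x t.
  by rewrite -[1]/(dd_one k gT) /dd_one linear_sum dcoef_sum.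
split=> [/ahom_inP[fM f1]|[fM f1]].
  split=> [g h g' h' x t|x t]; last by rewrite -R f1 dcoef1.
  by rewrite -dcoefM -fM ?memvf // ddM linearZ_LR dcoefZ.
apply/ahom_inP; split=> [X Y _ _|]; last first.
  by apply: dcoefP => x t; rewrite R f1 dcoef1.
rewrite (dd_decomp X) (dd_decomp Y) mulr_suml !linear_sum mulr_suml.
apply: eq_bigr => g _; rewrite mulr_suml !linear_sum mulr_suml.
apply: eq_bigr => h _; rewrite mulr_sumr !linear_sum mulr_sumr.
apply: eq_bigr => g' _; rewrite mulr_sumr !linear_sum mulr_sumr.
apply: eq_bigr => h' _; rewrite -scalerAl -scalerAr !linearZ_LR.
rewrite -scalerAl -scalerAr; congr (_ *: (_ *: _)); apply: dcoefP => x t.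
by rewrite ddM linearZ_LR dcoefZ dcoefM fM.
Qed.

Section Automorphism.
Variable psi : hopf_aut k gT.

Lemma hopf_aut_ker : lker psi == 0%VS.
Proof. by case: psi => f /= /and4P[]. Qed.

Lemma hopf_autK X : (psi^-1)%g (psi X) = X.
Proof. exact: lker0_lfunK hopf_aut_ker _. Qed.

Lemma hopf_autVK X : psi ((psi^-1)%g X) = X.
Proof. exact: lker0_lfunVK hopf_aut_ker _. Qed.

Lemma coef_comul g h x s x' s' : (s == s')%:R * coef psi g h (x' * x)%g s =
  \sum_a coef psi (a^-1 * g)%g h x s * coef psi a h x' s'.
Proof. by case: psi => f /= /and4P[_ /eqP/comul_coefP->]. Qed.

Lemma coef_counit g h : \sum_s coef psi g h 1%g s = (g == 1%g)%:R.
Proof. by case: psi => f /= /and4P[_ _ /eqP/counit_coefP->]. Qed.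

Lemma coef_mult g h g' h' x t :
  \sum_s coef psi g h x s * coef psi g' h' (s^-1 * x * s)%g (s^-1 * t)%g =
  (g == h * g' * h^-1)%g%:R * coef psi g (h * h')%g x t.
Proof. by have /ahom_coefP[-> _] := valP (hopf_aut_val psi). Qed.

Lemma coef_unit x t : \sum_g coef psi g 1%g x t = (t == 1%g)%:R.
Proof. by have /ahom_coefP[_ ->] := valP (hopf_aut_val psi). Qed.

Lemma coef_cancel g h x t :
  \sum_y \sum_s coef psi g h y s * coef (psi^-1)%g y s x t =
    ((x == g) && (t == h))%:R.
Proof. by rewrite -dcoef_lfun hopf_autK dcoef_dd. Qed.

Lemma coef_cancelV g h x t :
  \sum_y \sum_s coef (psi^-1)%g g h y s * coef psi y s x t =
    ((x == g) && (t == h))%:R.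
Proof. by rewrite -dcoef_lfun hopf_autVK dcoef_dd. Qed.

End Automorphism.
End HopfConditions.

Section Sums.
Variables (k : fieldType) (T : finType).

Lemma sum_deltal (a : T) (F : T -> k) : \sum_s (s == a)%:R * F s = F a.
Proof.
rewrite (bigD1 a) //= eqxx mul1r big1 ?addr0 // => s /negPf->.
by rewrite mul0r.
Qed.

Lemma sum_delta (a : T) : \sum_s (s == a)%:R = 1 :> k.
Proof. by under eq_bigr do rewrite -[_%:R]mulr1; rewrite sum_deltal. Qed.

(** Two nonzero entries cannot have product zero, so exactly one entry is nonzero, and being
    idempotent it is 1. This is how the maps [v] and [w] are extracted from linear data. *)
Lemma orth_idem_delta (f : T -> k) :
    (forall s s', f s * f s' = (s == s')%:R * f s) -> \sum_s f s = 1 ->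
  exists a, forall s, f s = (s == a)%:R.
Proof.
move=> ff f1; case: (pickP (fun s => f s != 0)) => [a fa|f0]; last first.
  have /eqP := f1; rewrite big1 1?eq_sym ?oner_eq0 // => s _.
  by apply/eqP; rewrite -[_ == _]negbK f0.
exists a => s; case: eqP => [->|sa].
  by apply: (mulfI fa); rewrite ff eqxx mul1r mulr1.
apply: (mulfI fa); rewrite ff mulr0; case: eqP => [as_|_];
last by rewrite mul0r.
by case: sa.
Qed.
End Sums.

(** * The structure of an automorphism *)

Section Structure.
Variables (k : fieldType) (gT : finGroupType).
Local Notation Z := 'Z([set: gT])%g.
Implicit Types (g h a x y t s z : gT).

Lemma centerTP z : reflect (forall g, z * g = g * z)%g (z \in Z).
Proof.
apply: (iffP (centerP _ _)) => [[_ zC] g|zC]; first by rewrite zC ?inE.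
by split=> [|g _]; rewrite ?inE.
Qed.

Lemma conj_notin_center z :
  z \notin Z -> exists h, (h * z * h^-1)%g != z.
Proof.
move=> nz; apply/existsP; apply: contraR nz; rewrite negb_exists => /forallP zC.
apply/centerTP=> g; have /negPn/eqP {1}<- := zC g; by rewrite mulgKV.
Qed.

(* The components of psi are p(e_g) = sum_s (c g s) s, u = the dual of w,     *)
(* r(h) = R h and v. The covers express that psi is injective and surjective. *)
Record component_spec (psi : hopf_aut k gT) (c : gT -> gT -> k)
    (w v : gT -> gT) (R : gT -> gT -> k) : Prop := ComponentSpec {
  spec_coef : forall g h x t,
    coef psi g h x t = c ((w x)^-1 * g)%g (t * (v h)^-1)%g * R h x;
  spec_centerl : forall g s, g \notin Z -> c g s = 0;
  spec_centerr : forall g s, s \notin Z -> c g s = 0;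
  spec_suml : forall s, \sum_g c g s = (s == 1%g)%:R;
  spec_sumr : forall g, \sum_s c g s = (g == 1%g)%:R;
  spec_w : {morph w : x y / (x * y)%g};
  spec_v : {morph v : x y / (x * y)%g};
  spec_Rl : forall h h' x, R (h * h')%g x = R h x * R h' x;
  spec_Rr : forall h x y, R h (x * y)%g = R h x * R h y;
  spec_R1r : forall h, R h 1%g = 1;
  spec_compat : forall h x, w (v h * x * (v h)^-1)%g = (h * w x * h^-1)%g;
  spec_cover_w : forall g, exists x s, c ((w x)^-1 * g)%g s != 0;
  spec_cover_v : forall t, exists h g, c g (t * (v h)^-1)%g != 0
}.

Variable psi : hopf_aut k gT.
Local Notation M := (coef psi).
(** [c g s] is the coefficient of s in p(e_g), [U g x] is u(e_g)(x), and [gam h] lists the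
    coefficients of psi(epsilon # h). *)
Let c g s := M g 1%g 1%g s.
Let U g x := \sum_s M g 1%g x s.
Let gam h x s := \sum_g M g h x s.

Let c_sumr g : \sum_s c g s = (g == 1%g)%:R.
Proof. exact: coef_counit. Qed.

Let c_suml s : \sum_g c g s = (s == 1%g)%:R.
Proof. exact: coef_unit. Qed.

Let convM g x s s' : (s == s')%:R * M g 1%g x s =
  \sum_a c (a^-1 * g)%g s * M a 1%g x s'.
Proof. by rewrite -coef_comul mulg1. Qed.

Let Mconv g x s s' : (s == s')%:R * M g 1%g x s =
  \sum_a M (a^-1 * g)%g 1%g x s * c a s'.
Proof. by rewrite -coef_comul mul1g. Qed.

Let MU g x s : M g 1%g x s = \sum_a c (a^-1 * g)%g s * U a x.
Proof.
transitivity (\sum_s' (s == s')%:R * M g 1%g x s).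
  rewrite -mulr_suml; under eq_bigr do rewrite eq_sym.
  by rewrite sum_delta mul1r.
under eq_bigr do rewrite convM; rewrite exchange_big; apply: eq_bigr => a _.
by rewrite -mulr_sumr.
Qed.

(* By comultiplicativity, convolution with c _ s on either side sends         *)
(* M _ 1 x s' to delta_(s,s') M _ 1 x s, and the M _ 1 x s' span k^G, as psi   *)
(* is injective.                                                              *)
Let c_classl b g s : c (b^-1 * g)%g s = c (g * b^-1)%g s.
Proof.
pose N := coef (psi^-1)%g.
have NM a : \sum_x \sum_s' M a 1%g x s' * N x s' b 1%g = (a == b)%:R.
  by rewrite coef_cancel eqxx andbT eq_sym.
transitivity (\sum_a (a == b)%:R * c (a^-1 * g)%g s);
first by rewrite sum_deltal.
transitivity (\sum_x \sum_s' (s == s')%:R * M g 1%g x s * N x s' b 1%g).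
  under eq_bigr do rewrite -NM mulr_suml.
  rewrite exchange_big; apply: eq_bigr => x _.
  under eq_bigr do rewrite mulr_suml.
  rewrite exchange_big; apply: eq_bigr => s' _; rewrite convM mulr_suml.
  by apply: eq_bigr => a _; rewrite mulrC mulrA.
transitivity (\sum_a (a == b)%:R * c (g * a^-1)%g s);
last by rewrite sum_deltal.
under [RHS]eq_bigr do rewrite -NM mulr_suml.
rewrite [RHS]exchange_big; apply: eq_bigr => x _.
under [RHS]eq_bigr do rewrite mulr_suml.
rewrite [RHS]exchange_big; apply: eq_bigr => s' _.
have -> : (s == s')%:R * M g 1%g x s = (s' == s)%:R * M g 1%g x s'.
  by case: (s =P s') => [->|/eqP]; rewrite ?eqxx // eq_sym => /negPf->;
  rewrite !mul0r.
rewrite Mconv mulr_suml (reindex_inj (mulgI g)) (reindex_inj invg_inj) /=.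
by apply: eq_bigr => a _; rewrite invMg invgK mulgKV mulrAC.
Qed.

Let c_conj h g s : c (h * g * h^-1)%g s = c g s.
Proof. by rewrite -c_classl mulKg. Qed.

Let p_orth g g' t :
  \sum_s c g s * c g' (s^-1 * t)%g = (g == g')%:R * c g t.
Proof.
have := coef_mult psi g 1%g g' 1%g 1%g t;
rewrite mul1g invg1 mulg1 !mul1g => <-.
by apply: eq_bigr => s _; rewrite mulg1 mulVg.
Qed.

(** The p(e_g) are orthogonal idempotents depending only on the class of g. For noncentral g, p(e_g)
    equals its product with p of a different conjugate, which is zero. *)
Let c_centerl g s : g \notin Z -> c g s = 0.
Proof.
move=> /conj_notin_center[h /negPf gh].
have := p_orth g g s; rewrite eqxx mul1r => <-.
under eq_bigr do rewrite -(c_conj h g (_ * _)%g).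
by rewrite p_orth eq_sym gh mul0r.
Qed.

(** The element epsilon # h is group-like, hence so is its image. *)
Let gam_mul h x x' s s' :
  (s == s')%:R * gam h (x' * x)%g s = gam h x s * gam h x' s'.
Proof.
rewrite mulr_sumr; under eq_bigr do rewrite coef_comul.
rewrite exchange_big mulr_sumr; apply: eq_bigr => a _.
by rewrite -mulr_suml (reindex_inj (mulgI a)); under eq_bigr do rewrite mulKg.
Qed.

Let gam_sum h : \sum_s gam h 1%g s = 1.
Proof.
rewrite exchange_big /=; under eq_bigr do rewrite coef_counit.
exact: sum_delta.
Qed.

(** A group-like element of kG is an element of G. *)
Let v_exists : exists v, forall h s, gam h 1%g s = (s == v h)%:R.
Proof.
apply: (fin_all_exists (P := fun h a => forall s, gam h 1%g s = (s == a)%:R)).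
move=> h; apply: orth_idem_delta => [s s'|].
  by rewrite -gam_mul mulg1.
exact: gam_sum.
Qed.

Section WithV.
Variable v : gT -> gT.
Hypothesis gam1 : forall h s, gam h 1%g s = (s == v h)%:R.
Let R h x := gam h x (v h).

Let gamE h x s : gam h x s = (s == v h)%:R * R h x.
Proof.
have := gam_mul h x 1%g s s; rewrite eqxx mul1r mul1g => ->.
by rewrite gam1 mulrC; case: eqP => [->|]; rewrite ?mul0r.
Qed.

Let R1 h : R h 1%g = 1.
Proof. by rewrite /R gam1 eqxx. Qed.

Let RM h x y : R h (x * y)%g = R h x * R h y.
Proof. by have := gam_mul h y x (v h) (v h); rewrite eqxx mul1r mulrC. Qed.

Let R_conj h x a : R h (a^-1 * x * a)%g = R h x.
Proof. by rewrite !RM mulrAC -RM mulVg R1 mul1r. Qed.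

Let R_neq0 h x : R h x != 0.
Proof.
have := oner_neq0 k; rewrite -(R1 h) -(mulgV x) RM.
by apply: contraNneq => ->; rewrite mul0r.
Qed.

Let mul_gam g h h' x t :
  \sum_s M g h x s * gam h' (s^-1 * x * s)%g (s^-1 * t)%g = M g (h * h')%g x t.
Proof.
under eq_bigr do rewrite mulr_sumr; rewrite exchange_big /=.
under eq_bigr do rewrite coef_mult.
rewrite (reindex_inj (conjg_inj h)) /= -[RHS](sum_deltal g
  (fun g => M g (h * h')%g x t)).
apply: eq_bigr => a _; rewrite /conjg !mulgA mulgV mul1g mulgK.
case: (altP (a =P g)) => [->|ag]; first by rewrite eqxx.
by rewrite eq_sym (negPf ag) !mul0r.
Qed.

Let gamM_mul g h h' x t :
  \sum_s gam h x s * M g h' (s^-1 * x * s)%g (s^-1 * t)%g =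
  M (h * g * h^-1)%g (h * h')%g x t.
Proof.
under eq_bigr do rewrite mulr_suml; rewrite exchange_big /=.
under eq_bigr do rewrite coef_mult.
exact: (sum_deltal (h * g * h^-1)%g (fun g => M g (h * h')%g x t)).
Qed.

Let sum_delta_mul t a (F : gT -> k) :
  \sum_s F s * (s^-1 * t == a)%g%:R = F (t * a^-1)%g.
Proof.
rewrite -[RHS](sum_deltal (t * a^-1)%g F); apply: eq_bigr => s _.
have -> : (s^-1 * t == a)%g = (s == t * a^-1)%g; last by rewrite mulrC.
apply/eqP/eqP=> [<-|->]; first by rewrite invMg invgK mulKVg.
by rewrite invMg invgK mulgKV.
Qed.

(** This is e_g # h = (e_g # 1)(epsilon # h); the character [R h] does not see the conjugation in
    the product. *)
Let M_R g h x t : M g h x t = M g 1%g x (t * (v h)^-1)%g * R h x.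
Proof.
rewrite -[h in LHS]mul1g -mul_gam.
under eq_bigr do rewrite gamE R_conj mulrA.
by rewrite -mulr_suml sum_delta_mul.
Qed.

Let gam_gam h h' x t :
  gam (h * h')%g x t = ((v h)^-1 * t == v h')%g%:R * (R h x * R h' x).
Proof.
rewrite {1}/gam; under eq_bigr do rewrite -mul_gam.
rewrite exchange_big /=; under eq_bigr do rewrite -mulr_suml -/(gam _ _ _) !gamE
  R_conj -mulrA.
by rewrite sum_deltal mulrCA.
Qed.

Let vM : {morph v : h h' / (h * h')%g}.
Proof.
move=> h h'; have := gam_gam h h' 1%g (v (h * h')%g).
rewrite gam1 eqxx !R1 mulr1; case: eqP => [<-|_ /eqP]; first by rewrite mulKVg.
by rewrite mulr1 oner_eq0.
Qed.

Let R_mull h h' x : R (h * h')%g x = R h x * R h' x.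
Proof. by rewrite {1}/R gam_gam vM mulKg eqxx mul1r. Qed.

Let M_conj g h x t :
  M g 1%g ((v h)^-1 * x * v h)%g ((v h)^-1 * t)%g =
  M (h * g * h^-1)%g 1%g x (t * (v h)^-1)%g.
Proof.
apply: (mulIf (R_neq0 h x)); have := gamM_mul g h 1%g x t.
rewrite mulg1 M_R => <-.
by under eq_bigr do rewrite gamE -mulrA; rewrite sum_deltal mulrC.
Qed.

(** For central g the element e_g # 1 is central in the double. Since psi is onto, e_1 # b is an
    image, and comparing both products with it shows that p(e_g) commutes with b. *)
Let c_classr g b t : c g (t * b^-1)%g = c g (b^-1 * t)%g.
Proof.
have [gZ|gZ] := boolP (g \in Z); last by rewrite !c_centerl.
pose N := coef (psi^-1)%g.
have NM t' : \sum_y \sum_s N 1%g b y s * M y s 1%g t' = (t' == b)%:R.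
  by rewrite coef_cancelV eqxx.
transitivity (\sum_y \sum_s N 1%g b y s * ((g == y)%:R * M g s 1%g t)).
  rewrite -(sum_delta_mul t b (c g)).
  under eq_bigr do rewrite -NM mulr_sumr.
  rewrite exchange_big; apply: eq_bigr => y _.
  under eq_bigr do rewrite mulr_sumr.
  rewrite exchange_big; apply: eq_bigr => s _.
  have := coef_mult psi g 1%g y s 1%g t; rewrite mul1g invg1 mulg1 !mul1g => <-.
  by rewrite mulr_sumr; apply: eq_bigr => s' _; rewrite mulg1 mulVg mulrCA.
rewrite -[RHS](sum_deltal b (fun s => c g (s^-1 * t)%g)).
under [RHS]eq_bigr do rewrite -NM mulr_suml.
rewrite [RHS]exchange_big; apply: eq_bigr => y _.
under [RHS]eq_bigr do rewrite mulr_suml.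
rewrite [RHS]exchange_big; apply: eq_bigr => s _.
under [RHS]eq_bigr do rewrite -mulrA; rewrite -mulr_sumr; congr (_ * _).
have := coef_mult psi y s g 1%g 1%g t.
rewrite -(centerTP _ gZ) mulgK mulg1 eq_sym => e.
transitivity ((y == g)%:R * M y s 1%g t).
  by rewrite [g == y]eq_sym; case: eqP => [->|]; rewrite ?mul0r.
by rewrite eq_sym -e; apply: eq_bigr => s' _; rewrite mulg1 mulVg.
Qed.

(** Dual to [c_centerl]: the functions [c _ s] are orthogonal idempotents for convolution, and
    [c _ s] is unchanged when s is replaced by a conjugate. *)
Let c_centerr g s : s \notin Z -> c g s = 0.
Proof.
move=> /conj_notin_center[h /negPf sh].
have sC a : c a (h * s * h^-1)%g = c a s by rewrite c_classr mulKg.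
have := convM g 1%g s s; rewrite eqxx mul1r -/(c g s) => ->.
transitivity (\sum_a c (a^-1 * g)%g s * M a 1%g 1%g (h * s * h^-1)%g).
  by apply: eq_bigr => a _; congr (_ * _); exact/esym/sC.
by rewrite -convM eq_sym sh mul0r.
Qed.

Let M_centerr g x s : s \notin Z -> M g 1%g x s = 0.
Proof.
move=> sZ; rewrite MU big1 // => a _.
by rewrite c_centerr ?mul0r.
Qed.

(** Only central s contribute, so the conjugation s^-1 * x * s disappears and the product of the
    double becomes the pointwise one. *)
Let U_orth g g' x : U g x * U g' x = (g == g')%:R * U g x.
Proof.
transitivity (\sum_t \sum_s
    M g 1%g x s * M g' 1%g (s^-1 * x * s)%g (s^-1 * t)%g); last first.
  under eq_bigr do rewrite coef_mult.
  by rewrite -mulr_sumr mul1g invg1 !mulg1.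
rewrite [RHS]exchange_big mulr_suml; apply: eq_bigr => s _ /=.
rewrite -mulr_sumr; have [sZ|sZ] := boolP (s \in Z); last first.
  by rewrite M_centerr ?mul0r.
rewrite -mulgA -(centerTP _ sZ) mulKg; congr (_ * _).
by rewrite (reindex_inj (mulgI s)); apply: eq_bigr => t _; rewrite mulKg.
Qed.

Let U_sum x : \sum_g U g x = 1.
Proof.
rewrite exchange_big /=; under eq_bigr do rewrite coef_unit.
exact: sum_delta.
Qed.

Let w_exists : exists w, forall x g, U g x = (g == w x)%:R.
Proof.
apply: (fin_all_exists (P := fun x a => forall g, U g x = (g == a)%:R)) => x.
by apply: orth_idem_delta => [g g'|]; [exact: U_orth | exact: U_sum].
Qed.

Let U_conv g x x' : U g (x' * x)%g = \sum_a U (a^-1 * g)%g x * U a x'.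
Proof.
transitivity (\sum_s \sum_s' (s == s')%:R * M g 1%g (x' * x)%g s).
  apply: eq_bigr => s _; rewrite -mulr_suml.
  by under eq_bigr do rewrite eq_sym; rewrite sum_delta mul1r.
under [RHS]eq_bigr do rewrite mulr_suml; rewrite [RHS]exchange_big.
apply: eq_bigr => s _; under [RHS]eq_bigr do rewrite mulr_sumr.
rewrite [RHS]exchange_big; apply: eq_bigr => s' _.
by rewrite coef_comul.
Qed.

Let nat_of_bool_inj (b b' : bool) : b%:R = b'%:R :> k -> b = b'.
Proof. by case: b b' => -[] // /eqP; rewrite ?oner_eq0 // eq_sym oner_eq0. Qed.

Lemma component_spec_v : exists c w R, component_spec psi c w v R.
Proof.
have [w wE] := w_exists; exists c, w, R.
have Mw g x s : M g 1%g x s = c ((w x)^-1 * g)%g s.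
  rewrite MU; under eq_bigr do rewrite wE mulrC; by rewrite sum_deltal.
split=> //.
- by move=> g h x t; rewrite M_R Mw.
- move=> x' x; have := U_conv (w (x' * x)%g) x x'.
  under eq_bigr do rewrite !wE mulrC.
  rewrite sum_deltal wE eqxx => /esym/(nat_of_bool_inj (b' := true))/eqP<-.
  by rewrite mulKVg.
- move=> h x; have e : U (w x) x = U (h * w x * h^-1)%g (v h * x * (v h)^-1)%g.
    rewrite {1}/U (reindex_inj (mulgI (v h)^-1)%g) /=.
    rewrite [RHS](reindex_inj (mulIg (v h)^-1)%g) /=.
    by apply: eq_bigr => t _; rewrite -M_conj !mulgA mulVg mul1g mulgKV.
  by move: e; rewrite !wE eqxx => /(nat_of_bool_inj (b := true))/esym/eqP.
(* Otherwise psi(e_g # 1) = 0, against injectivity. *)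
- move=> g; suff /existsP[x /existsP[s cxs]] :
    [exists x, exists s, c ((w x)^-1 * g)%g s != 0] by exists x, s.
  have := coef_cancel psi g 1%g g 1%g; rewrite !eqxx; apply: contra_eqT.
  move=> /existsPn c0; rewrite big1 1?eq_sym ?oner_eq0 // => x _.
  rewrite big1 // => s _; have /existsPn/(_ s)/negPn/eqP := c0 x.
  by rewrite Mw => ->; rewrite mul0r.
(* Otherwise no image under psi has a nonzero coefficient at e_1 # t, against surjectivity. *)
- move=> t; suff /existsP[h /existsP[g chg]] :
    [exists h, exists g, c g (t * (v h)^-1)%g != 0] by exists h, g.
  have := coef_cancelV psi 1%g t 1%g t; rewrite !eqxx; apply: contra_eqT.
  move=> /existsPn c0; rewrite big1 1?eq_sym ?oner_eq0 // => y _.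
  rewrite big1 // => h _; have /existsPn/(_ ((w 1)^-1 * y)%g)/negPn/eqP := c0 h.
  by rewrite M_R Mw => ->; rewrite mul0r mulr0.
Qed.

End WithV.

Theorem component_specP : exists c w v R, component_spec psi c w v R.
Proof.
have [v vE] := v_exists; have [c' [w [R spec]]] := component_spec_v vE.
by exists c', w, v, R.
Qed.

End Structure.

(** * The components u, p, r, v in terms of [w], [c], [R], [v] *)

Section Components.
Variables (k : fieldType) (gT : finGroupType).
Local Notation D := (drinfeld_double k gT).
Local Notation dd := (dd k).
Local Notation Z := 'Z([set: gT])%g.
Implicit Types (X : D) (psi : hopf_aut k gT) (g h x y t s : gT).

Lemma id_counitE X x : id_counit k gT X x = \sum_t dcoef X x t :> k.
Proof.
rewrite /id_counit lin_extE sum_ffunE.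
transitivity (\sum_g \sum_t (g == x)%:R * dcoef X g t).
  rewrite pair_bigA; apply: (@eq_bigr k 0 +%R) => -[g t] _ /=.
  by rewrite !ffunE /= eq_sym; exact: mulrC.
by under eq_bigr do rewrite -mulr_sumr; rewrite sum_deltal.
Qed.

Lemma ev1_idE X t : ev1_id k gT X t = dcoef X 1%g t :> k.
Proof.
rewrite /ev1_id lin_extE sum_ffunE.
transitivity (\sum_g \sum_s (g == 1%g)%:R * ((s == t)%:R * dcoef X g s)).
  rewrite pair_bigA; apply: (@eq_bigr k 0 +%R) => -[g s] _ /=.
  rewrite !ffunE /= [t == s]eq_sym [1%g == g]eq_sym.
  by rewrite [LHS]mulrC [RHS]mulrA.
under eq_bigr do rewrite -mulr_sumr; rewrite sum_deltal.
exact: sum_deltal.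
Qed.

Lemma dcoef_smash (a : {ffun gT -> k^o}) (h g t : gT) :
  dcoef (smash a (basis_vec h)) g t = a g * (t == h)%:R.
Proof. by rewrite /dcoef !ffunE. Qed.

Lemma dcoef_psi_smash psi (a : {ffun gT -> k^o}) (h x t : gT) :
  dcoef (psi (smash a (basis_vec h))) x t = \sum_g (a g : k) * coef psi g h x t.
Proof.
rewrite dcoef_lfun; apply: eq_bigr => g _.
under eq_bigr do rewrite dcoef_smash -mulrA mulrCA; exact: sum_deltal.
Qed.

Lemma basis_vec_eq x y :
  basis_vec x y = basis_vec x x :> k^o -> y = x.
Proof. by rewrite !ffunE eqxx; case: eqP => // _ /esym/eqP; rewrite oner_eq0.
Qed.

Lemma basis_vec_inj : injective (@basis_vec k gT).
Proof.
by move=> x y xy; apply/esym/basis_vec_eq; rewrite {1}xy !ffunE !eqxx.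
Qed.

Section Spec.
Variables (psi : hopf_aut k gT) (c : gT -> gT -> k) (w v : gT -> gT).
Variable R : gT -> gT -> k.
Hypothesis spec : component_spec psi c w v R.

Lemma spec_w1 : w 1%g = 1%g.
Proof. by apply: (mulgI (w 1)); rewrite -(spec_w spec) !mulg1. Qed.

Lemma spec_v1 : v 1%g = 1%g.
Proof. by apply: (mulgI (v 1)); rewrite -(spec_v spec) !mulg1. Qed.

Lemma spec_R_neq0 h x : R h x != 0.
Proof.
have := oner_neq0 k; rewrite -(spec_R1r spec h) -(mulgV x) (spec_Rr spec).
by apply: contraNneq => ->; rewrite mul0r.
Qed.

Lemma spec_R1l x : R 1%g x = 1.
Proof.
by apply: (mulfI (spec_R_neq0 1%g x)); rewrite -(spec_Rl spec) mulg1 mulr1.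
Qed.

Lemma sum_coef_r g h x : \sum_t coef psi g h x t = (g == w x)%:R * R h x.
Proof.
under eq_bigr do rewrite (spec_coef spec); rewrite -mulr_suml.
rewrite (reindex_inj (mulIg (v h))) /=; under eq_bigr do rewrite mulgK.
by rewrite (spec_sumr spec) -eq_mulVg1 eq_sym.
Qed.

Lemma sum_coef_l h x t : \sum_g coef psi g h x t = (t == v h)%:R * R h x.
Proof.
under eq_bigr do rewrite (spec_coef spec); rewrite -mulr_suml.
rewrite (reindex_inj (mulgI (w x))) /=; under eq_bigr do rewrite mulKg.
by rewrite (spec_suml spec) -eq_mulgV1.
Qed.

Lemma comp_uE (a : {ffun gT -> k^o}) x : comp_u psi a x = a (w x).
Proof.
rewrite /comp_u id_counitE; under eq_bigr do rewrite dcoef_psi_smash.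
rewrite exchange_big /=; under eq_bigr do rewrite -mulr_sumr sum_coef_r spec_R1l
  mulr1 mulrC.
exact: sum_deltal.
Qed.

Lemma comp_pE (a : {ffun gT -> k^o}) t :
  comp_p psi a t = \sum_g (a g : k) * c g t :> k.
Proof.
rewrite /comp_p ev1_idE dcoef_psi_smash; apply: eq_bigr => g _.
by rewrite (spec_coef spec) spec_w1 spec_v1 !invg1 mul1g mulg1 spec_R1l mulr1.
Qed.

Lemma comp_rE h x : comp_r psi h x = R h x.
Proof.
rewrite /comp_r id_counitE; under eq_bigr do rewrite dcoef_psi_smash.
rewrite -[RHS](sum_deltal (v h) (fun=> R h x)); apply: eq_bigr => t _.
by rewrite -sum_coef_l; apply: eq_bigr => g _; rewrite ffunE mul1r.
Qed.

Lemma comp_vE h : comp_v psi h = basis_vec (v h).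
Proof.
apply/ffunP=> t; rewrite /comp_v ev1_idE dcoef_psi_smash.
under eq_bigr do rewrite ffunE mul1r; rewrite sum_coef_l ffunE.
by rewrite (spec_R1r spec) mulr1.
Qed.

Lemma Lambda_spec : Lambda psi <->
  [/\ forall x, w x = x, forall h, v h = h & forall h x, R h x = 1].
Proof.
split=> [[u1 v1 r1]|[w1 v1 R1]]; split.
- move=> x; have /ffunP/(_ x) := u1 (basis_vec x).
  by rewrite comp_uE => /basis_vec_eq.
- by move=> h; apply: basis_vec_inj; rewrite -comp_vE v1.
- by move=> h x; rewrite -comp_rE r1 ffunE.
- by move=> a; apply/ffunP=> x; rewrite comp_uE w1.
- by move=> g; rewrite comp_vE v1.
- by move=> h; apply/ffunP=> x; rewrite comp_rE R1 ffunE.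
Qed.

Lemma trivial_p_spec : trivial_p psi <->
  forall g s, c g s = ((g == 1%g) && (s == 1%g))%:R.
Proof.
split=> [p1 g s|c1 a]; last first.
  apply/ffunP=> t; rewrite comp_pE ffunE ffunE.
  under eq_bigr do rewrite c1 -mulnb natrM mulrCA.
  exact: sum_deltal.
have /ffunP/(_ s) := p1 (basis_vec g); rewrite comp_pE.
under eq_bigr do rewrite ffunE; rewrite sum_deltal => ->.
by rewrite !ffunE eq_sym -mulnb natrM.
Qed.

End Spec.

End Components.

Arguments basis_vec_inj {k gT}.

Section Surjection.
Variable T : finType.

Lemma surj_perm (f : T -> T) :
  (forall y, exists x, f x = y) -> exists p : {perm T}, forall x, f x = p x.
Proof.
move=> fS; have [g fK] := fin_all_exists fS.
by exists (perm (can_inj (canF_sym fK))) => x; rewrite permE.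
Qed.

End Surjection.

(** * Monomial automorphisms and the subgroup K *)

Section HopfAutBuild.
Variables (k : fieldType) (gT : finGroupType).
Local Notation D := (drinfeld_double k gT).

Lemma hopf_aut_build (f : 'End(D)) :
    lker f == 0%VS ->
    (forall g h g' h' x t,
       \sum_s coef f g h x s * coef f g' h' (s^-1 * x * s)%g (s^-1 * t)%g =
       (g == h * g' * h^-1)%g%:R * coef f g (h * h')%g x t) ->
    (forall x t, \sum_g coef f g 1%g x t = (t == 1%g)%:R) ->
    (forall g h x s x' s', (s == s')%:R * coef f g h (x' * x)%g s =
       \sum_a coef f (a^-1 * g)%g h x s * coef f a h x' s') ->
    (forall g h, \sum_s coef f g h 1%g s = (g == 1%g)%:R) ->
    (forall g h x s, coef f g h (s^-1 * x^-1 * s)%g s^-1%g =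
       coef f (h^-1 * g^-1 * h)%g h^-1%g x s) ->
  exists psi : hopf_aut k gT, psi = f :> 'End(D).
Proof.
move=> f0 fM f1 fD fe fS.
have fA : ahom_in {:D} f by apply/ahom_coefP.
have fH : is_hopf_aut (AHom fA).
  apply/and4P; split => //=.
  - by apply/eqP/comul_coefP.
  - by apply/eqP/counit_coefP.
  - by apply/eqP/antipode_coefP.
by exists (HopfAut fH).
Qed.

Lemma hopf_aut_eqP (psi psi' : hopf_aut k gT) :
  (forall g h, psi (dd k g h) = psi' (dd k g h)) -> psi = psi'.
Proof.
by move=> e; apply: hopf_aut_eq; apply: lfun_coefP => g h x t; rewrite /coef e.
Qed.

Lemma mul_hopf_autE (psi psi' : hopf_aut k gT) X :
  (psi * psi')%g X = psi (psi' X).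
Proof. exact: comp_lfunE. Qed.

Lemma one_hopf_autE X : (1%g : hopf_aut k gT) X = X.
Proof. exact: id_lfunE. Qed.

End HopfAutBuild.

Section Monomial.
Variables (k : fieldType) (gT : finGroupType).
Local Notation D := (drinfeld_double k gT).
Local Notation dd := (dd k).
Local Notation Z := 'Z([set: gT])%g.
Implicit Types (psi : hopf_aut k gT) (g h x y t s : gT) (w v : {perm gT}).
Implicit Types (rho : gT -> gT -> k).

(** Here [w] acts on basis vectors, so it is the inverse of the [w] of [component_spec], which
    describes u by precomposition. *)
Definition monomial psi w v rho :=
  forall g h, psi (dd g h) = rho g h *: dd (w g) (v h).

Lemma monomial_ext psi w v rho rho' :
  rho =2 rho' -> monomial psi w v rho -> monomial psi w v rho'.
Proof. by move=> e m g h; rewrite m e. Qed.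

Lemma monomial_coef psi w v rho g h x t : monomial psi w v rho ->
  coef psi g h x t = rho g h * ((x == w g) && (t == v h))%:R.
Proof. by move=> m; rewrite /coef m dcoefZ dcoef_dd. Qed.

Lemma dd_neq0 g h : dd g h != 0.
Proof.
apply/eqP=> /(congr1 (fun X => dcoef X g h)); rewrite dcoef_dd !eqxx.
by rewrite /dcoef ffunE => /eqP; rewrite oner_eq0.
Qed.

Lemma monomial_neq0 psi w v rho g h : monomial psi w v rho -> rho g h != 0.
Proof.
move=> m; apply: contra_neq (dd_neq0 g h) => r0.
by rewrite -[dd g h](hopf_autK psi) m r0 scale0r linear0.
Qed.

Lemma monomial_one : monomial 1%g 1%g 1%g (fun _ _ => 1).
Proof. by move=> g h; rewrite one_hopf_autE scale1r !perm1. Qed.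

Lemma monomial_mul psi psi' w v rho w' v' rho' :
    monomial psi w v rho -> monomial psi' w' v' rho' ->
  monomial (psi * psi')%g (w' * w)%g (v' * v)%g
    (fun g h => rho' g h * rho (w' g) (v' h)).
Proof.
by move=> m m' g h; rewrite mul_hopf_autE m' linearZ_LR /= m scalerA !permM.
Qed.

Lemma monomial_inv psi w v rho : monomial psi w v rho ->
  monomial psi^-1%g w^-1%g v^-1%g
    (fun g h => (rho (w^-1%g g) (v^-1%g h))^-1).
Proof.
move=> m g h; rewrite -[X in _ *: X](hopf_autK psi) m !permKV linearZ_LR /=.
by rewrite scalerA mulVf ?scale1r // (monomial_neq0 _ _ m).
Qed.

Lemma monomial_trivial_p psi w v rho : monomial psi w v rho -> trivial_p psi.
Proof.
move=> m; have [c [w' [v' [R sp]]]] := component_specP psi.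
apply/(trivial_p_spec sp) => g s.
have sE g' h x t := monomial_coef g' h x t m.
have r1 g' : rho g' 1%g * (1%g == w g')%:R = (g' == 1%g)%:R.
  rewrite -(coef_counit psi g' 1%g);
  under eq_bigr do rewrite sE andbC -mulnb natrM mulrCA.
  by rewrite sum_deltal.
have v1 : v 1%g = 1%g.
  apply/eqP; have := coef_unit psi 1%g (v 1%g).
  under eq_bigr do rewrite sE eqxx andbT r1.
  by rewrite sum_delta; case: eqP => // _ /eqP; rewrite oner_eq0.
have := spec_coef sp g 1%g 1%g s.
rewrite (spec_w1 sp) (spec_v1 sp) !invg1 mul1g mulg1 (spec_R1r sp) mulr1 => <-.
by rewrite sE v1 -!mulnb !natrM mulrA r1.
Qed.

(** With [c] concentrated at (1, 1), the covering conditions say that [w] and [v] are onto, hence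
    bijective. *)
Lemma trivial_p_monomial psi : trivial_p psi ->
  exists w v rho, monomial psi w v rho.
Proof.
have [c [w' [v' [R sp]]]] := component_specP psi.
move/(trivial_p_spec sp) => c1.
have [|v vE] := @surj_perm _ v'.
  move=> t; have [h [g]] := spec_cover_v sp t; rewrite c1 -eq_mulgV1.
  by case: (t =P v' h) => [->|_]; [exists h | rewrite andbF eqxx].
have [|w wE] := @surj_perm _ w'.
  move=> g; have [x [s]] := spec_cover_w sp g; rewrite c1 -eq_mulVg1.
  by case: (w' x =P g) => [<-|_]; [exists x | rewrite eqxx].
exists w^-1%g, v, (fun g h => R h (w^-1%g g)) => g h; apply: dcoefP => x t.
rewrite -/(coef _ _ _ _ _) (spec_coef sp) c1 dcoefZ dcoef_dd -vE wE.
rewrite -eq_mulgV1 -eq_mulVg1 (can2_eq (permK w) (permKV w)) mulrC.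
case: eqP => [->|_] //=; by rewrite !mulr0.
Qed.

Lemma component_spec_ext psi c (w v : gT -> gT) R (w' v' : gT -> gT) R' :
    w =1 w' -> v =1 v' -> R =2 R' ->
  component_spec psi c w v R -> component_spec psi c w' v' R'.
Proof.
move=> ew ev eR s; split.
- by move=> g h x t; rewrite (spec_coef s) ew ev eR.
- exact: spec_centerl s.
- exact: spec_centerr s.
- exact: spec_suml s.
- exact: spec_sumr s.
- by move=> x y; rewrite -!ew (spec_w s).
- by move=> x y; rewrite -!ev (spec_v s).
- by move=> h h' x; rewrite -!eR (spec_Rl s).
- by move=> h x y; rewrite -!eR (spec_Rr s).
- by move=> h; rewrite -eR (spec_R1r s).
- by move=> h x; rewrite -!ev -!ew (spec_compat s).
- by move=> g; have [x [t cx]] := spec_cover_w s g; exists x, t; rewrite -ew.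
- by move=> t; have [x [g cx]] := spec_cover_v s t; exists x, g; rewrite -ev.
Qed.

Lemma monomial_spec psi w v rho : monomial psi w v rho ->
  exists c, component_spec psi c w^-1%g v (fun h x => rho (w^-1%g x) h).
Proof.
move=> m; have [c [w' [v' [R sp]]]] := component_specP psi; exists c.
have c1 := (trivial_p_spec sp).1 (monomial_trivial_p m).
have E g h x t : rho g h * ((x == w g) && (t == v h))%:R =
    ((w' x == g) && (t == v' h))%:R * R h x.
  by rewrite -(monomial_coef _ _ _ _ m) (spec_coef sp) c1 -eq_mulgV1 -eq_mulVg1.
have E1 g h : [/\ w' (w g) = g, v' h = v h & rho g h = R h (w g)].
  have := E g h (w g) (v h); rewrite !eqxx mulr1; case: eqP => [->|_] /=.
    by case: eqP => [->|_]; rewrite ?mul1r // mul0r => /eqP/negPn;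
       rewrite (monomial_neq0 _ _ m).
  by rewrite mul0r => /eqP/negPn; rewrite (monomial_neq0 _ _ m).
have wE x : w' x = w^-1%g x.
  by have [+ _ _] := E1 (w^-1%g x) 1%g; rewrite permKV.
have vE h : v' h = v h by have [_ + _] := E1 1%g h.
have rE h x : R h x = rho (w^-1%g x) h.
  by have [_ _ ->] := E1 (w^-1%g x) h; rewrite permKV.
exact: (component_spec_ext wE vE rE sp).
Qed.
End Monomial.

Section MonomialGroup.
Variables (k : fieldType) (gT : finGroupType).
Local Notation D := (drinfeld_double k gT).
Local Notation dd := (dd k).
Local Notation Z := 'Z([set: gT])%g.
Implicit Types (psi : hopf_aut k gT) (g h x y t s : gT) (w v : {perm gT}).
Implicit Types (rho : gT -> gT -> k).

(** The third hypothesis is the relation (epsilon # h)(e_g # 1) = e_(h g h^-1) # h transported by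
    (w, v). *)
Lemma monomial_build w v rho :
    {morph w : x y / (x * y)%g} -> {morph v : x y / (x * y)%g} ->
    (forall g h, w (h * g * h^-1)%g = (v h * w g * (v h)^-1)%g) ->
    (forall g g' h, rho (g * g')%g h = rho g h * rho g' h) ->
    (forall g h h', rho g (h * h')%g = rho g h * rho g h') ->
    (forall h, rho 1%g h = 1) -> (forall g, rho g 1%g = 1) ->
  exists psi, monomial psi w v rho.
Proof.
move=> wM vM wv rMl rMr r1l r1r.
have w1 : w 1%g = 1%g by apply: (mulgI (w 1%g)); rewrite -wM !mulg1.
have v1 : v 1%g = 1%g by apply: (mulgI (v 1%g)); rewrite -vM !mulg1.
have wV x : w x^-1%g = (w x)^-1%g.
  by apply: (mulgI (w x)); rewrite -wM !mulgV.
have vV x : v x^-1%g = (v x)^-1%g.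
  by apply: (mulgI (v x)); rewrite -vM !mulgV.
have wJ g h : w (h^-1 * g * h)%g = ((v h)^-1 * w g * v h)%g.
  by have := wv g h^-1%g; rewrite vV !invgK.
have r0 g h : rho g h != 0.
  have := oner_neq0 k; rewrite -(r1l h) -(mulgV g) rMl.
  by apply: contraNneq => ->; rewrite mul0r.
have rJ g x h : rho (x * g * x^-1)%g h = rho g h.
  by rewrite !rMl mulrAC -rMl mulgV r1l mul1r.
pose f : 'End(D) :=
  lin_ext (fun b : gT * gT => rho b.1 b.2 *: dd (w b.1) (v b.2)).
have fE g h : f (dd g h) = rho g h *: dd (w g) (v h).
  by rewrite /f lin_ext_basis.
have cE g h y u :
    coef f g h (w y) (v u) = (y == g)%:R * ((u == h)%:R * rho g h).
  by rewrite /coef fE dcoefZ dcoef_dd !(inj_eq perm_inj) -mulnb natrM mulrC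
    mulrA.
have [||||||psi psiE] := @hopf_aut_build k gT f.
- apply/lker0P=> X Y XY; apply: dcoefP => x t.
  have : dcoef (f X) (w x) (v t) = dcoef (f Y) (w x) (v t) by rewrite XY.
  have E X' : dcoef (f X') (w x) (v t) = rho x t * dcoef X' x t.
    rewrite dcoef_lfun.
    transitivity (\sum_g (g == x)%:R * \sum_h (h == t)%:R *
      (rho g h * dcoef X' g h)).
      apply: eq_bigr => g _; rewrite mulr_sumr; apply: eq_bigr => h _.
      by rewrite cE [g == x]eq_sym [h == t]eq_sym mulrC -!mulrA.
    by rewrite !sum_deltal.
  by rewrite !E => /(mulfI (r0 x t)).
- move=> g h g' h' x t; rewrite -(permKV w x) -(permKV v t).
  move: (w^-1%g x) (v^-1%g t) => y u.
  rewrite (reindex_inj (@perm_inj _ v)) /=.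
  transitivity (\sum_s (s == h)%:R * ((y == g)%:R * rho g h *
    coef f g' h' (w (h^-1 * y * h)%g) (v (h^-1 * u)%g))).
    apply: eq_bigr => s _; rewrite cE; case: (s =P h) => [->|_]; last first.
      by rewrite !mul0r mulr0 !mul0r.
    rewrite !mul1r; congr (_ * coef f _ _ _ _); by rewrite ?wJ // vM vV.
  rewrite sum_deltal !cE; case: (y =P g) => [->|_];
  last by rewrite !(mul0r, mulr0).
  have -> : ((h^-1 * g * h)%g == g') = (g == (h * g' * h^-1)%g).
    by apply/eqP/eqP=> [<-|->];
    rewrite !mulgA ?mulgV ?mulVg !mul1g ?mulgK ?mulgKV.
  have -> : ((h^-1 * u)%g == h') = (u == (h * h')%g).
    by apply/eqP/eqP=> [<-|->]; rewrite ?mulKg ?mulKVg.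
  case: (g =P _) => [->|_]; last by rewrite !(mul0r, mulr0).
  by rewrite !mul1r rMr !rJ mulrCA.
- move=> x t; rewrite -(permKV w x) -(permKV v t) -[in RHS]v1 (inj_eq perm_inj).
  under eq_bigr do rewrite cE eq_sym; by rewrite sum_deltal r1r mulr1.
- move=> g h x s x' s'; rewrite -(permKV w x) -(permKV w x') -(permKV v s)
    -(permKV v s').
  move: (w^-1%g x) (w^-1%g x') (v^-1%g s) (v^-1%g s') => y y' u u'.
  transitivity (\sum_a (a == y')%:R * (coef f (a^-1 * g)%g h (w y) (v u) *
    ((u' == h)%:R * rho a h))); last first.
    by apply: eq_bigr => a _; rewrite mulrCA; congr (_ * _); rewrite cE eq_sym.
  rewrite sum_deltal -wM !cE (inj_eq perm_inj).
  have -> : (y == (y'^-1 * g)%g) = ((y' * y)%g == g).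
    by apply/eqP/eqP=> [->|<-]; [rewrite mulKVg | rewrite mulKg].
  case: ((y' * y)%g =P g) => [<-|_]; last by rewrite !(mul0r, mulr0).
  rewrite mulKg; case: (u =P h) => [->|_]; last by rewrite !(mul0r, mulr0).
  by rewrite [h == u']eq_sym rMl !mul1r [rho y' h * _]mulrC mulrCA.
- move=> g h; under eq_bigr do rewrite -[s in coef _ _ _ _ s](permKV v) -w1 cE.
  rewrite -mulr_sumr (reindex_inj (@perm_inj _ v)) /=.
  under eq_bigr do rewrite permK; rewrite sum_deltal eq_sym.
  by case: eqP => [->|_]; rewrite ?mul0r // r1l mulr1.
- move=> g h x s; rewrite -(permKV w x) -(permKV v s).
  move: (w^-1%g x) (v^-1%g s) => y u.
  rewrite -wV -wJ -vV !cE.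
  have -> : (u^-1 == h)%g = (u == h^-1)%g.
    by rewrite -(inj_eq invg_inj) invgK.
  case: (u =P _) => [->|_]; last by rewrite !(mul0r, mulr0).
  have -> : ((h^-1)^-1 * y^-1 * h^-1 == g)%g = (y == h^-1 * g^-1 * h)%g.
    rewrite invgK; apply/eqP/eqP=> [<-|->];
    rewrite !invMg !invgK !mulgA ?mulVg ?mulgV !mul1g ?mulgK ?mulgKV //.
  rewrite !mul1r; congr (_ * _).
  rewrite -{3}[h]invgK rJ; apply: (mulfI (r0 g h)).
  have rV : rho g h * rho g^-1%g h = 1 by rewrite -rMl mulgV r1l.
  apply: (mulIf (r0 g^-1%g h)); rewrite mulrAC rV mul1r.
  by rewrite -mulrA -rMr mulVg r1r mulr1.
by exists psi => g h; rewrite psiE fE.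
Qed.
End MonomialGroup.

(** * K as the semidirect product of SpAut_c(G) and Hom(G, G^) *)

Section KDecomposition.
Variables (k : fieldType) (gT : finGroupType).
Local Notation dd := (dd k).
Local Notation Z := 'Z([set: gT])%g.
Implicit Types (psi : hopf_aut k gT) (g h x y t s : gT) (w v : {perm gT}).
Implicit Types (rho : gT -> gT -> k).

Lemma K_aut_monomial psi : K_aut psi <-> exists w v rho, monomial psi w v rho.
Proof.
by split=> [/trivial_p_monomial|[w [v [rho /monomial_trivial_p]]]].
Qed.

Lemma perm_in_Aut w : reflect {morph w : x y / (x * y)%g} (w \in Aut [set: gT]).
Proof.
rewrite inE; apply: (iffP andP) => [[_ /morphicP wM] x y|wM].
  by rewrite wM ?inE.
split; first by apply/subsetP=> x; rewrite inE.
by apply/morphicP=> x y _ _; exact: wM.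
Qed.

Lemma monomial_compat psi w v rho : monomial psi w v rho ->
  [/\ {morph w : x y / (x * y)%g}, {morph v : x y / (x * y)%g} &
      forall g h, w (h * g * h^-1)%g = (v h * w g * (v h)^-1)%g].
Proof.
move/monomial_spec=> [c sp]; have wM := spec_w sp; split.
- by move=> x y; apply: (@perm_inj _ w^-1%g); rewrite wM !permK.
- exact: spec_v sp.
- move=> g h; apply: (@perm_inj _ w^-1%g).
  by rewrite (spec_compat sp) !permK.
Qed.

Lemma monomial_rho psi w v rho : monomial psi w v rho ->
  [/\ forall g g' h, rho (g * g')%g h = rho g h * rho g' h,
      forall g h h', rho g (h * h')%g = rho g h * rho g h',
      forall h, rho 1%g h = 1 & forall g, rho g 1%g = 1].
Proof.
move=> m; have [wM _ _] := monomial_compat m; have [c sp] := monomial_spec m.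
have w1 : w 1%g = 1%g by apply: (mulgI (w 1%g)); rewrite -wM !mulg1.
split.
- by move=> g g' h; have := spec_Rr sp h (w g) (w g'); rewrite -wM !permK.
- by move=> g h h'; have := spec_Rl sp h h' (w g); rewrite !permK.
- by move=> h; have := spec_R1r sp h; rewrite -{1}w1 permK.
- by move=> g; have := spec_R1l sp (w g); rewrite permK.
Qed.

(** Centrality of w^-1 v is automatic: by [monomial_compat], w^-1(v(g)) and g induce the same
    conjugation, so they differ by a central element. *)
Lemma SpAut_c_monomial psi :
  SpAut_c psi <-> exists w v, monomial psi w v (fun _ _ => 1).
Proof.
split=> [[w [v [_ _ _ m]]]|[w [v m]]]; exists w, v.
  by move=> g h; rewrite m scale1r.
have [wM vM wv] := monomial_compat m.
split; [exact/perm_in_Aut|exact/perm_in_Aut| |]; last first.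
  by move=> g h; rewrite m scale1r.
move=> g; set z := w^-1%g (v g).
have zE x : (z * x * z^-1 = g * x * g^-1)%g.
  apply: (@perm_inj _ w); have wV y : w y^-1%g = (w y)^-1%g.
    by apply: (mulgI (w y)); rewrite -wM !mulgV -[RHS](mulgV (w 1%g))
      -{1}[1%g in RHS]mulg1 wM mulgK.
  by rewrite wv !wM wV permKV.
apply/centerTP=> x; have e : (z * (g^-1 * x * g) * z^-1)%g = x.
  by rewrite zE !mulgA mulgV mul1g mulgK.
by rewrite -{2}e -!mulgA mulKg mulgV mulg1.
Qed.

Lemma Hom_G_Ghat_monomial psi :
  Hom_G_Ghat psi <-> exists rho, monomial psi 1%g 1%g rho.
Proof.
have smE (a : {ffun gT -> k^o}) g h :
    smash (a * basis_vec g) (basis_vec h) = (a g : k) *: dd g h.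
  apply: dcoefP => x t; rewrite dcoef_smash dcoefZ dcoef_dd !ffunE.
  rewrite -mulnb natrM; case: eqP => [->|_]; first exact/esym/mulrA.
  by rewrite mul0r mulr0 mulr0 mul0r.
split=> [[r [_ _ m]]|[rho m]].
  by exists (fun g h => r h g) => g h; rewrite m smE !perm1.
have [rMl rMr r1l r1r] := monomial_rho m.
exists (fun h => [ffun g => rho g h]); split.
- move=> h; split=> [g|g g']; rewrite !ffunE; last exact: rMl.
  exact: (monomial_neq0 g h m).
- by move=> h h'; apply/ffunP=> g; rewrite !ffunE rMr.
- by move=> g h; rewrite m smE ffunE !perm1.
Qed.

Lemma monomial_eq1 psi w v rho rho' :
  monomial psi 1%g 1%g rho -> monomial psi w v (fun _ _ => 1) -> psi = 1%g.
Proof.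
move=> m m'; apply: hopf_aut_eqP => g h; rewrite one_hopf_autE m !perm1.
suff -> : rho g h = 1 by rewrite scale1r.
have := monomial_coef g h (w g) (v h) m; rewrite (monomial_coef _ _ _ _ m').
rewrite !eqxx mulr1 !perm1; case: andP => [_|_ /eqP]; first by rewrite mulr1.
by rewrite mulr0 oner_eq0.
Qed.

Lemma K_aut_sdprod :
  internal_sdprod (@K_aut k gT) (@Hom_G_Ghat k gT) (@SpAut_c k gT).
Proof.
split.
- split=> [|x y /Hom_G_Ghat_monomial[r m] /Hom_G_Ghat_monomial[r' m']].
    by apply/Hom_G_Ghat_monomial; eexists; exact: monomial_one.
  apply/Hom_G_Ghat_monomial; have := monomial_mul m (monomial_inv m').
  by rewrite invg1 mulg1 => M; eexists; exact: M.
- split=> [|x y /SpAut_c_monomial[w [v m]] /SpAut_c_monomial[w' [v' m']]].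
    by apply/SpAut_c_monomial; do 2 eexists; exact: monomial_one.
  apply/SpAut_c_monomial; do 2 eexists.
  by apply: monomial_ext (monomial_mul m (monomial_inv m')) => g h;
  rewrite invr1 mulr1.
- move=> x y /Hom_G_Ghat_monomial[r m] /K_aut_monomial[w [v [r' m']]].
  apply/Hom_G_Ghat_monomial.
  have := monomial_mul (monomial_inv m') (monomial_mul m m').
  by rewrite !mulg1 !mulgV => M; eexists; exact: M.
- move=> x /Hom_G_Ghat_monomial[r m] /SpAut_c_monomial[w [v m']].
  exact: monomial_eq1 m m'.
- move=> x; split=> [/K_aut_monomial[w [v [r m]]]|].
    have [wM vM wv] := monomial_compat m.
    (* The factor [z] keeps the two permutations and drops the scalars, so that x z^-1 fixes every
       basis vector up to a scalar. *)
    have [||||z mz] := @monomial_build k gT w v (fun _ _ => 1) wM vM wv;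
      do ?by move=> *; rewrite ?mulr1.
    exists (x * z^-1)%g, z; split; last by rewrite mulgKV.
      apply/Hom_G_Ghat_monomial; have := monomial_mul m (monomial_inv mz).
      by rewrite !mulVg => M; eexists; exact: M.
    by apply/SpAut_c_monomial; exists w, v.
  move=> [y [z [/Hom_G_Ghat_monomial[r m] /SpAut_c_monomial[w [v m']] ->]]].
  by apply/K_aut_monomial; do 3 eexists; exact: monomial_mul m m'.
Qed.

Lemma K_aut_subgroup : is_subgroup (@K_aut k gT).
Proof.
split=> [|x y /K_aut_monomial[w [v [r m]]] /K_aut_monomial[w' [v' [r' m']]]].
  by apply/K_aut_monomial; do 3 eexists; exact: monomial_one.
by apply/K_aut_monomial; do 3 eexists; exact: monomial_mul m (monomial_inv m').
Qed.

End KDecomposition.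

(** * Stem groups *)

Section StemGroup.
Variables (gT : finGroupType).
Hypothesis stem : stem_group gT.
Local Notation Z := 'Z([set: gT])%g.

Lemma stem_center_sub (H : {group gT}) z :
  (forall x y, [~ x, y]%g \in H) -> z \in Z -> z \in H.
Proof.
move=> Hcomm; apply: subsetP; apply: subset_trans stem _.
by rewrite gen_subG; apply/subsetP=> _ /imset2P[x y _ _ ->].
Qed.

(** The values commute, so the kernel of [f] contains all commutators, hence G' and Z(G). *)
Lemma stem_center_char (k : fieldType) (f : gT -> k) z :
    (forall x y, f (x * y)%g = f x * f y) -> f 1%g = 1 -> z \in Z -> f z = 1.
Proof.
move=> fM f1 zZ.
have ker_group : group_set [set x | f x == 1].
  apply/group_setP; split=> [|x y]; rewrite !inE ?f1 // => /eqP fx /eqP fy.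
  by rewrite fM fx fy mulr1.
suff : z \in Group ker_group by rewrite inE => /eqP.
apply: stem_center_sub zZ => x y; rewrite inE /commg /conjg !fM.
by rewrite [f x * _]mulrC [f y^-1%g * _]mulrA -[f _ * f y]fM mulVg f1 mul1r -fM
  mulVg f1.
Qed.

(** As G = f(G) Z(G), every commutator of G is a commutator of elements of f(G). Hence Z(G) <= G' <=
    f(G), and so f(G) = G. *)
Lemma stem_cover_surj (f : gT -> gT) :
    {morph f : x y / (x * y)%g} ->
    (forall t, exists h, (t * (f h)^-1)%g \in Z) -> forall t, exists h, f h = t.
Proof.
move=> fM fZ.
have f1 : f 1%g = 1%g by apply: (mulgI (f 1%g)); rewrite -fM !mulg1.
have fV x : f x^-1%g = (f x)^-1%g by apply: (mulgI (f x)); rewrite -fM !mulgV.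
have im_group : group_set [set f x | x in gT].
  apply/group_setP; split=> [|_ _ /imsetP[x _ ->] /imsetP[y _ ->]].
    by apply/imsetP; exists 1%g.
  by apply/imsetP; exists (x * y)%g.
have ZH z : z \in Z -> exists h, f h = z.
  move=> zZ; suff /imsetP[h _ ->] : z \in Group im_group by exists h.
  apply: stem_center_sub zZ => x y.
  have [h hZ] := fZ x; have [h' h'Z] := fZ y; apply/imsetP;
  exists [~ h, h']%g => //.
  have -> : x = (x * (f h)^-1 * f h)%g by rewrite mulgKV.
  have -> : y = (y * (f h')^-1 * f h')%g by rewrite mulgKV.
  move: (_ * _^-1)%g (y * _^-1)%g hZ h'Z => a b aZ bZ.
  have aC u : [~ a, u]%g = 1%g by apply/eqP/commgP; exact: centerTP _ aZ u.
  have bC u : [~ u, b]%g = 1%g.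
    by apply/eqP/commgP; exact/commute_sym/(centerTP _ bZ u).
  by rewrite commMgJ aC conj1g mul1g commgMJ bC conj1g mulg1 /commg /conjg !fM
    !fV.
move=> t; have [h /ZH[h' h'E]] := fZ t; exists (h' * h)%g.
by rewrite fM h'E mulgKV.
Qed.

End StemGroup.

(** * Automorphisms of the double of a stem group *)

Section StemAutomorphisms.
Variables (k : fieldType) (gT : finGroupType).
Hypothesis stem : stem_group gT.
Local Notation Z := 'Z([set: gT])%g.
Implicit Types (psi : hopf_aut k gT) (g h x y t s : gT).

Lemma stem_spec_perm psi c w v R : component_spec psi c w v R ->
  exists W V : {perm gT}, w =1 W /\ v =1 V.
Proof.
move=> sp.
have [|W wE] := @surj_perm _ w.
  apply: (stem_cover_surj stem (spec_w sp)) => g.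
  have [x [s cx]] := spec_cover_w sp g; exists x.
  suff zZ : ((w x)^-1 * g)%g \in Z.
    by rewrite -[g](mulKVg (w x)) -(centerTP _ zZ) mulgK.
  by apply: contraNT cx => /(spec_centerl sp)->.
have [|V vE] := @surj_perm _ v; last by exists W, V.
apply: (stem_cover_surj stem (spec_v sp)) => t.
have [h [g ch]] := spec_cover_v sp t; exists h.
by apply: contraNT ch => /(spec_centerr sp)->.
Qed.

(* Since G is a stem group, r(h) is trivial on Z(G) and r(z) is trivial for   *)
(* z in Z(G), so that p does not contribute to the u, v, r of a product.      *)
Lemma stem_spec_mul psi c w v R psi' c' w' v' R' c'' w'' v'' R'' :
    component_spec psi c w v R -> component_spec psi' c' w' v' R' ->
    component_spec (psi * psi')%g c'' w'' v'' R'' ->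
  [/\ forall x, w'' x = w' (w x), forall h, v'' h = v (v' h) &
      forall h x, R'' h x = R' h (w x) * R (v' h) x].
Proof.
move=> sp sp' sp''.
have mE g h x t : coef (psi * psi')%g g h x t =
    \sum_y \sum_s coef psi' g h y s * coef psi y s x t.
  by rewrite {1}/coef mul_hopf_autE dcoef_lfun.
have vR h x t : (t == v'' h)%:R * R'' h x =
    (t == v (v' h))%:R * (R' h (w x) * R (v' h) x).
  rewrite -(sum_coef_l sp''); under eq_bigr do rewrite mE.
  rewrite exchange_big /=.
  transitivity (\sum_y R' h (w x) * coef psi y (v' h) x t); last first.
    by rewrite -mulr_sumr (sum_coef_l sp) mulrCA.
  apply: eq_bigr => y _; rewrite exchange_big /=.
  under eq_bigr do rewrite -mulr_suml (sum_coef_l sp') -mulrA.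
  rewrite sum_deltal (spec_coef sp).
  (* The kernel [c] forces y = w(x) a with a central, and R'(h) is 1 on a. *)
  have [aZ|aZ] := boolP (((w x)^-1 * y)%g \in Z); last first.
    by rewrite (spec_centerl sp) // !(mul0r, mulr0).
  have Ra := stem_center_char stem (spec_Rr sp' h) (spec_R1r sp' h) aZ.
  by rewrite -{1}[y](mulKVg (w x)) (spec_Rr sp') Ra mulr1.
split=> [x|h|h x].
- have : (w'' x == w' (w x))%:R = 1 :> k.
    have := sum_coef_r sp'' (w'' x) 1%g x.
    rewrite eqxx mul1r (spec_R1l sp'') => e; rewrite -[RHS]e {e}.
    under [RHS]eq_bigr do rewrite mE.
    rewrite [RHS]exchange_big /=.
    transitivity (\sum_y (y == w x)%:R * (w'' x == w' y)%:R : k).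
      by rewrite sum_deltal.
    apply: eq_bigr => y _; rewrite [RHS]exchange_big /=.
    under [RHS]eq_bigr do rewrite -mulr_sumr (sum_coef_r sp) mulrCA.
    rewrite -mulr_sumr; congr (_ * _).
    have := sum_coef_r sp' (w'' x) 1%g y; rewrite (spec_R1l sp') mulr1 => e;
    rewrite -[LHS]e {e}.
    (* Only central s survive, and the character s |-> R(s)(x) is 1 on them. *)
    apply: eq_bigr => s _; have [sZ|sZ] := boolP (s \in Z); last first.
      by rewrite (spec_coef sp') (spec_v1 sp') invg1 mulg1 (spec_centerr sp') //
        !mul0r.
    have RMx s1 s2 : R (s1 * s2)%g x = R s1 x * R s2 x := spec_Rl sp s1 s2 x.
    by rewrite (stem_center_char stem RMx (spec_R1l sp x) sZ) mulr1.
  by case: eqP => // _ /esym/eqP; rewrite oner_eq0.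
- have := vR h 1%g (v'' h); rewrite eqxx mul1r; case: (v'' h =P _) => // _.
  by move/eqP; rewrite mul0r (negPf (spec_R_neq0 sp'' _ _)).
- have := vR h x (v'' h); rewrite eqxx mul1r.
  case: (v'' h =P _) => [_ ->|_ /eqP]; first by rewrite mul1r.
  by rewrite mul0r (negPf (spec_R_neq0 sp'' _ _)).
Qed.

Lemma Lambda_mul_cancelr psi phi :
  Lambda (psi * phi)%g -> Lambda phi -> Lambda psi.
Proof.
have [c [w [v [R sp]]]] := component_specP psi.
have [c' [w' [v' [R' sp']]]] := component_specP phi.
have [c'' [w'' [v'' [R'' sp'']]]] := component_specP (psi * phi)%g.
have [wE vE RE] := stem_spec_mul sp sp' sp''.
move=> /(Lambda_spec sp'')[w1'' v1'' R1''] /(Lambda_spec sp')[w1' v1' R1'].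
apply/(Lambda_spec sp); split=> [x|h|h x].
- by rewrite -[RHS]w1'' wE w1'.
- by rewrite -[in RHS](v1'' h) vE v1'.
- by rewrite -(R1'' h x) RE R1' mul1r v1'.
Qed.

(** From 1 * 1 = 1, the bijections [w] and [v] are idempotent, hence the identity, and then the
    nonzero values of [R] are idempotent, hence 1. *)
Lemma Lambda1 : Lambda (1%g : hopf_aut k gT).
Proof.
have [c [w [v [R sp]]]] := component_specP (1%g : hopf_aut k gT).
have sp1 : component_spec (1 * 1)%g c w v R by rewrite mulg1.
have [W [V [wW vV]]] := stem_spec_perm sp.
have [wE vE RE] := stem_spec_mul sp sp sp1.
have w1 x : w x = x by apply: (@perm_inj _ W); rewrite -!wW -wE.
have v1 h : v h = h by apply: (@perm_inj _ V); rewrite -!vV -vE.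
apply/(Lambda_spec sp); split=> // h x.
by apply: (mulfI (spec_R_neq0 sp h x)); rewrite mulr1 [RHS]RE w1 v1.
Qed.

Lemma stem_Lambda_normal : is_normal (@Lambda k gT).
Proof.
split.
  split=> [|x y Lx Ly]; first exact: Lambda1.
  by apply: Lambda_mul_cancelr Ly; rewrite mulgKV.
(* Comparing the components of y z and x y avoids those of y^-1. *)
move=> x y; set z := (x ^ y)%g; have e : (y * z = x * y)%g.
  by rewrite /z /conjg mulKVg.
have [cx [wx [vx [Rx spx]]]] := component_specP x.
have [cy [wy [vy [Ry spy]]]] := component_specP y.
have [cz [wz [vz [Rz spz]]]] := component_specP z.
have [c [w [v [R sp]]]] := component_specP (x * y)%g.
move=> /(Lambda_spec spx)[wx1 vx1 Rx1].
have [wE vE RE] := stem_spec_mul spx spy sp.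
have sp' := sp; rewrite -e in sp'.
have [wE' vE' RE'] := stem_spec_mul spy spz sp'.
have [W [V [wW vV]]] := stem_spec_perm spy.
have vz1 h : vz h = h by apply: (@perm_inj _ V); rewrite -!vV -vE' vE vx1.
apply/(Lambda_spec spz); split=> // [x0|h x0].
  by rewrite -[x0](permKV W) -wW -wE' wE wx1.
rewrite -[x0](permKV W) -wW; set y0 := W^-1%g x0.
apply: (mulIf (spec_R_neq0 spy h y0)).
by rewrite mul1r -{2}[h]vz1 -RE' RE wx1 Rx1 mulr1.
Qed.

Lemma stem_decomposition psi :
  exists y z : hopf_aut k gT, [/\ Lambda y, K_aut z & psi = (y * z)%g].
Proof.
have [c [w [v [R sp]]]] := component_specP psi.
have [W [V [wW vV]]] := stem_spec_perm sp.
have wM := spec_w sp; have vM := spec_v sp.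
have WM : {morph W^-1%g : x y / (x * y)%g}.
  by move=> x y; apply: (@perm_inj _ W); rewrite -[RHS]wW wM !wW !permKV.
have VM : {morph V : x y / (x * y)%g} by move=> x y; rewrite -!vV vM.
(* This [z] is the element of K with the same [w], [v] and [R] as psi; the scalar uses W^-1 because
   the basis index is w^-1(x). *)
have [|||||z mz] := @monomial_build k gT W^-1%g V
    (fun g h => R h (W^-1%g g)) WM VM.
- move=> g h; apply: (@perm_inj _ W).
  by rewrite -[RHS]wW -vV (spec_compat sp) wW !permKV.
- by move=> g g' h; rewrite WM (spec_Rr sp).
- by move=> g h h'; rewrite (spec_Rl sp).
- move=> h; have -> : W^-1%g 1%g = 1%g.
    by apply: (@perm_inj _ W); rewrite permKV -wW (spec_w1 sp).
  exact: spec_R1r sp h.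
- by move=> g; rewrite (spec_R1l sp).
have [cz spz] := monomial_spec mz.
have [cy [wy [vy [Ry spy]]]] := component_specP (psi * z^-1)%g.
have sp' : component_spec (psi * z^-1 * z)%g c w v R by rewrite mulgKV.
have [wE vE RE] := stem_spec_mul spy spz sp'.
exists (psi * z^-1)%g, z; split; last by rewrite mulgKV.
  have wy1 x : wy x = x by have := wE x; rewrite invgK wW => /perm_inj.
  apply/(Lambda_spec spy); split=> // [h|h x].
    by rewrite -[h](permKV V) -vE vV.
  have := RE (V^-1%g h) x; rewrite /= wy1 invgK permK permKV => e.
  by apply: (mulfI (spec_R_neq0 sp (V^-1%g h) x)); rewrite mulr1 -e.
by apply/K_aut_monomial; do 3 eexists; exact: mz.
Qed.

Lemma Lambda_K_trivial psi : Lambda psi -> K_aut psi -> psi = 1%g.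
Proof.
have [c [w [v [R sp]]]] := component_specP psi.
move=> /(Lambda_spec sp)[w1 v1 R1] /(trivial_p_spec sp) c1.
apply: hopf_aut_eqP => g h; rewrite one_hopf_autE; apply: dcoefP => x t.
rewrite -/(coef _ _ _ _ _) (spec_coef sp) w1 v1 R1 c1 dcoef_dd mulr1.
by rewrite -eq_mulVg1 -eq_mulgV1.
Qed.

Lemma stem_sdprod :
  internal_sdprod (fun _ => True) (@Lambda k gT) (@K_aut k gT).
Proof.
have [Lsub Lnormal] := stem_Lambda_normal.
split=> // [|x y Lx _|x|x]; first exact: K_aut_subgroup.
- exact: Lnormal.
- exact: Lambda_K_trivial.
- by split=> // _; exact: stem_decomposition.
Qed.

End StemAutomorphisms.

(** * Groups that are not stem *)

Section Pairings.
Variables (k : closedFieldType) (gT : finGroupType).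
Hypothesis k_pchar0 : [pchar k] =i pred0.
Local Notation Z := 'Z([set: gT])%g.

(** In characteristic zero X^n - 1 is separable, so it has n distinct roots in k. *)
Lemma closed_prim_root_exists n :
  (n > 0)%N -> exists z : k, n.-primitive_root z.
Proof.
pose p : {poly k} := 'X^n - 1; have [r Dp] := closed_field_poly_normal p.
move=> n_gt0; rewrite (monicP _) ?monicXnsubC // scale1r in Dp.
have rn1 : all n.-unity_root r by apply/allP=> z; rewrite -root_prod_XsubC -Dp.
have sz_r : (n < (size r).+1)%N.
  by rewrite -(size_prod_XsubC r id) -Dp size_XnsubC.
have [|z] := hasP (has_prim_root n_gt0 rn1 _ sz_r); last by exists z.
by rewrite -separable_prod_XsubC -Dp separable_Xn_sub_1 // (pcharf0P k).1 //
  -lt0n.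
Qed.

(** Let e(g) be the exponent of g in the cyclic quotient and z a primitive root of unity of its
    order. The pairing is z^(e(g) e(h)); for h over the generator it is a faithful character of the
    quotient, so it detects c0. *)
Lemma cyclic_quotient_pairing (N : {group gT}) c0 :
    (N <| [set: gT])%g -> cyclic ([set: gT] / N)%g -> c0 \notin N ->
  exists rho : gT -> gT -> k,
    [/\ forall g g' h, rho (g * g')%g h = rho g h * rho g' h,
        forall g h h', rho g (h * h')%g = rho g h * rho g h',
        forall h, rho 1%g h = 1, forall g, rho g 1%g = 1
      & exists h, rho c0 h != 1].
Proof.
move=> nN /cyclicP[xb cyc] c0N.
have nNG g : g \in 'N(N)%g by apply: (subsetP (normal_norm nN)); rewrite inE.
have /fin_all_exists[e eE] g : exists i, coset N g = (xb ^+ i)%g.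
  by apply/cycleP; rewrite -cyc mem_quotient ?inE.
have [z zP] := closed_prim_root_exists (order_gt0 xb).
have eM g g' : z ^+ e (g * g')%g = z ^+ e g * z ^+ e g'.
  rewrite -exprD; apply/eqP; rewrite (eq_prim_root_expr zP) -eq_expg_mod_order.
  by rewrite expgD -!eE morphM.
have e1 : z ^+ e 1%g = 1.
  apply/eqP; rewrite -[1](expr0 z) (eq_prim_root_expr zP) -eq_expg_mod_order.
  by rewrite -eE morph1.
pose rho g h := z ^+ (e g * e h)%N.
have rhoC g h : rho g h = rho h g by rewrite /rho mulnC.
have rMl g g' h : rho (g * g')%g h = rho g h * rho g' h.
  by rewrite /rho !exprM eM exprMn.
have r1l h : rho 1%g h = 1 by rewrite /rho exprM e1 expr1n.
exists rho; split=> // [g h h'|g|]; first by rewrite !(rhoC g) rMl.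
  by rewrite rhoC.
have /morphimP[h _ _ hE] : xb \in ([set: gT] / N)%g by rewrite cyc cycle_id.
exists h; apply: contraNneq c0N => /eqP r1.
have ze : z ^+ e h = z.
  apply/eqP; rewrite -[X in _ == X](expr1 z) (eq_prim_root_expr zP)
    -eq_expg_mod_order.
  by rewrite -eE expg1 hE.
apply: coset_idr (nNG c0) _; apply/eqP.
rewrite eE -(expg0 xb) eq_expg_mod_order -(eq_prim_root_expr zP) expr0.
by move: r1; rewrite /rho mulnC exprM ze.
Qed.

(** G' is the intersection of the kernels of the complex linear characters, so one of them is
    nontrivial at c0. Only its kernel N is kept: G / N is cyclic, and the pairing into k is built
    from that quotient. *)
Lemma nonstem_pairing : ~~ stem_group gT -> exists2 c0, c0 \in Z &
  exists rho : gT -> gT -> k,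
    [/\ forall g g' h, rho (g * g')%g h = rho g h * rho g' h,
        forall g h h', rho g (h * h')%g = rho g h * rho g h',
        forall h, rho 1%g h = 1, forall g, rho g 1%g = 1
      & exists h, rho c0 h != 1].
Proof.
case/subsetPn=> c0 c0Z; rewrite -(cap_cfker_lin_irr [group of [set: gT]]) =>
  c0D.
exists c0 => //.
have /existsP[i /andP[lin_i c0i]] :
    [exists i, ('chi[[group of [set: gT]]]_i \is a linear_char) &&
      (c0 \notin cfker 'chi_i)].
  apply: contraR c0D => /existsPn iD; apply/bigcapP=> i lin_i.
  by have := iD i; rewrite lin_i negbK.
apply: cyclic_quotient_pairing c0i; first exact: cfker_normal.
suff ZT : 'Z('chi_i)%CF = [set: gT].
  by have := cfcenter_cyclic 'chi_i; rewrite ZT.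
apply/setP=> x; rewrite irr_cfcenterE ?inE // lin_char1 //.
by rewrite normC_lin_char ?inE // eqxx.
Qed.

Lemma sum_nontrivial_char (C : {group gT}) (f : gT -> k) c0 :
    {in C &, forall x y, f (x * y)%g = f x * f y} -> c0 \in C -> f c0 != 1 ->
  \sum_(g in C) f g = 0.
Proof.
move=> fM c0C fc0; set S := \sum_(g in C) _.
have : f c0 * S = S.
  rewrite /S [RHS](reindex_inj (mulgI c0)) mulr_sumr.
  apply: eq_big => [g|g gC]; first by rewrite groupMl.
  by rewrite fM.
move/eqP; rewrite -[X in _ == X]mul1r -subr_eq0 -mulrBl mulf_eq0 subr_eq0.
by rewrite (negPf fc0) => /eqP.
Qed.

End Pairings.

(** * Automorphisms built from a kernel on the center *)

Section CentralKernel.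
Variables (k : fieldType) (gT : finGroupType).
Local Notation D := (drinfeld_double k gT).
Local Notation dd := (dd k).
Local Notation Z := 'Z([set: gT])%g.
Implicit Types (g h x y t s : gT).

(* c is the matrix of a Hopf algebra map p(e_g) = sum_s (c g s) s from k^G to *)
(* kG that factors through a map k^Z -> kZ, where Z is the center of G.       *)
Record central_kernel (c : gT -> gT -> k) : Prop := CentralKernel {
  kernel_centerl : forall g s, g \notin Z -> c g s = 0;
  kernel_centerr : forall g s, s \notin Z -> c g s = 0;
  kernel_orthr : forall g g' t,
    \sum_s c g s * c g' (s^-1 * t)%g = (g == g')%:R * c g t;
  kernel_orthl : forall g s s',
    \sum_a c (a^-1 * g)%g s * c a s' = (s == s')%:R * c g s;
  kernel_sumr : forall g, \sum_s c g s = (g == 1%g)%:R;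
  kernel_suml : forall s, \sum_g c g s = (s == 1%g)%:R;
  kernel_inv : forall g s, c g^-1%g s = c g s^-1%g
}.

Lemma kernel_hopf_aut c : central_kernel c -> exists psi : hopf_aut k gT,
  forall g h x t, coef psi g h x t = c (x^-1 * g)%g (t * h^-1)%g.
Proof.
move=> cK.
have conj_center h z : ((h^-1 * z * h)%g \in Z) = (z \in Z).
  apply/idP/idP=> /centerTP zC; apply/centerTP=> u; last first.
    have -> : (h^-1 * z * h)%g = z by rewrite -mulgA zC mulKg.
    exact: zC.
  have := zC h; rewrite !mulgA mulgV mul1g => zh.
  have -> : z = (h^-1 * z * h)%g by apply: (mulIg h); rewrite -zh.
  exact: zC.
have cJl g h s : c (h^-1 * g * h)%g s = c g s.
  have [gZ|gZ] := boolP (g \in Z);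
  last by rewrite !(kernel_centerl cK) ?conj_center.
  by rewrite -mulgA (centerTP _ gZ) mulKg.
have cJr g h s : c g (h^-1 * s * h)%g = c g s.
  have [sZ|sZ] := boolP (s \in Z);
  last by rewrite !(kernel_centerr cK) ?conj_center.
  by rewrite -mulgA (centerTP _ sZ) mulKg.
have cCl g g' s : c (g * g')%g s = c (g' * g)%g s.
  by rewrite -(cJl _ g) mulKg.
have cCr g s s' : c g (s * s')%g = c g (s' * s)%g.
  by rewrite -(cJr _ s) mulKg.
pose f : 'End(D) := lin_ext (fun b : gT * gT =>
  [ffun y : gT * gT => c (y.1^-1 * b.1)%g (y.2 * b.2^-1)%g] : D).
have cE g h x t : coef f g h x t = c (x^-1 * g)%g (t * h^-1)%g.
  by rewrite /coef /dcoef /f /dd lin_ext_basis ffunE.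
have [||||||psi psiE] := @hopf_aut_build k gT f.
- apply/lker0P=> X Y XY.
  (* An explicit left inverse of [f]: its kernel is [c] with the first argument inverted, the
     convolution inverse of p. *)
  have E X' y u : dcoef X' y u =
      \sum_x \sum_t c (x^-1 * y)%g (u * t^-1)%g * dcoef (f X') x t.
    transitivity (\sum_g \sum_h dcoef X' g h *
        (\sum_x \sum_t c (x^-1 * y)%g (u * t^-1)%g * c (x^-1 * g)%g
          (t * h^-1)%g)).
      transitivity (\sum_g (g == y)%:R * \sum_h (h == u)%:R * dcoef X' g h).
        by rewrite !sum_deltal.
      apply: eq_bigr => g _; rewrite mulr_sumr; apply: eq_bigr => h _.
      rewrite mulrA mulrC; congr (_ * _).
      under [RHS]eq_bigr => x _.
        rewrite (reindex_inj (mulIg u)) (reindex_inj invg_inj) /=.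
        under eq_bigr => s _ do rewrite invMg invgK mulKVg -mulgA.
        rewrite (kernel_orthr cK) (inj_eq (mulgI _)); over.
      rewrite -mulr_sumr (reindex_inj (mulgI y)) (reindex_inj invg_inj) /=.
      under eq_bigr => x _ do rewrite invMg invgK mulgKV.
      by rewrite (kernel_suml cK) -eq_mulgV1 [y == g]eq_sym [u == h]eq_sym.
    under eq_bigr => g _ do under eq_bigr => h _ do rewrite mulr_sumr.
    under eq_bigr => g _ do rewrite exchange_big /=.
    rewrite exchange_big; apply: eq_bigr => x _ /=.
    under eq_bigr => g _ do under eq_bigr => h _ do rewrite mulr_sumr.
    under eq_bigr => g _ do rewrite exchange_big /=.
    rewrite exchange_big; apply: eq_bigr => t _ /=.
    rewrite dcoef_lfun mulr_sumr; apply: eq_bigr => g _.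
    rewrite mulr_sumr; apply: eq_bigr => h _.
    by rewrite cE mulrCA.
  by apply: dcoefP => y u; rewrite !E XY.
- move=> g h g' h' x t; under eq_bigr do rewrite !cE.
  rewrite (reindex_inj (mulIg h)) /= cE.
  (* With s = z h, only central z contribute; they conjugate x trivially, and the remaining
     conjugation by h is absorbed by [cJl] and [cCr]. *)
  transitivity (\sum_z c (x^-1 * g)%g z *
      c (x^-1 * (h * g' * h^-1))%g (z^-1 * (t * (h * h')^-1))%g).
    apply: eq_bigr => z _; rewrite mulgK.
    have [zZ|zZ] := boolP (z \in Z); last first.
      by rewrite (kernel_centerr cK) // !mul0r.
    congr (_ * _); have zC := centerTP _ zZ.
    have -> : ((z * h)^-1 * x * (z * h))%g = (h^-1 * x * h)%g.
      by rewrite invMg -!mulgA; congr (_ * _)%g;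
      rewrite [(x * _)%g]mulgA -zC mulgA mulKg.
    have -> : ((h^-1 * x * h)^-1 * g' = h^-1 * (x^-1 * (h * g' * h^-1)) * h)%g.
      by rewrite !invMg invgK !mulgA mulgKV.
    rewrite cJl.
    have -> : ((z * h)^-1 * t * h'^-1 = h^-1 * (z^-1 * t * h'^-1))%g.
      by rewrite invMg !mulgA.
    by rewrite cCr invMg !mulgA.
  by rewrite (kernel_orthr cK) (inj_eq (mulgI _)).
- move=> x t; under eq_bigr do rewrite cE invg1 mulg1.
  by rewrite (reindex_inj (mulgI x)) /=; under eq_bigr do rewrite mulKg;
  rewrite (kernel_suml cK).
- move=> g h x s x' s'; rewrite cE [RHS](reindex_inj (mulgI x')) /=.
  rewrite -(inj_eq (mulIg h^-1%g)) -(kernel_orthl cK); apply: eq_bigr => a _.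
  rewrite !cE mulKg; have [aZ|aZ] := boolP (a \in Z); last first.
    by rewrite (kernel_centerl cK (s' * _)%g aZ) !mulr0.
  have aC : (a^-1 * x^-1)%g = (x^-1 * a^-1)%g.
    by rewrite -!invMg (centerTP _ aZ).
  by rewrite !invMg mulgA mulgA aC !mulgA.
- move=> g h; under eq_bigr do rewrite cE invg1 mul1g.
  by rewrite (reindex_inj (mulIg h)) /=; under eq_bigr do rewrite mulgK;
  rewrite (kernel_sumr cK).
- move=> g h x s; rewrite !cE -[(s^-1 * h^-1)%g]invMg -(kernel_inv cK) !invgK
    [in RHS]cCr.
  have [zZ|zZ] := boolP ((h * s)%g \in Z);
  last by rewrite !(kernel_centerr cK _ zZ).
  have sJ : (s^-1 * x^-1 * s = h * x^-1 * h^-1)%g.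
    have zC := centerTP _ zZ.
    have -> : s = (h * s * h^-1)%g by rewrite zC mulKg.
    move: (h * s)%g zC => z zC; rewrite invMg invgK -!mulgA; congr (_ * _)%g.
    by rewrite [(x^-1 * (z * _))%g]mulgA -zC -mulgA mulKg.
  rewrite [((_ * g)^-1)%g]invMg invgK sJ [LHS]cCl [(x^-1 * _)%g in RHS]mulgA
    [RHS]cCl.
  by rewrite !mulgA.
by exists psi => g h x t; rewrite -cE psiE.
Qed.

End CentralKernel.

(** * The Fourier kernel and the failure of normality *)

Section NonStem.
Variables (k : closedFieldType) (gT : finGroupType).
Hypothesis k_pchar0 : [pchar k] =i pred0.
Local Notation Z := 'Z([set: gT])%g.
Implicit Types (g h x y t s : gT).

(* Fourier transform on the cyclic group <[c0]>. *)
Lemma cyclic_kernel (c0 : gT) : c0 \in Z -> exists2 c : gT -> gT -> k,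
  central_kernel c & forall g, c g 1%g = (g \in <[c0]>%g)%:R / #[c0]%g%:R.
Proof.
move=> c0Z; pose C := <[c0]>%G; pose m : k := #[c0]%g%:R.
have m0 : m != 0 by rewrite (pcharf0P k).1 // -lt0n order_gt0.
have CZ z : z \in C -> z \in Z by apply: subsetP; rewrite cycle_subG.
(* [dl] is a discrete logarithm to base c0; outside C its value is arbitrary, and [c] below vanishes
   there. *)
have /fin_all_exists[dl dlE] (s : gT) : exists i, s \in C -> s = (c0 ^+ i)%g.
  have [/cycleP[i ->]|_] := boolP (s \in C); first by exists i.
  by exists 0%N.
have [z zP] := closed_prim_root_exists k_pchar0 (order_gt0 c0).
have zM : {in C &, forall g g', z ^+ dl (g * g')%g = z ^+ dl g * z ^+ dl g'}.
  move=> g g' gC g'C; rewrite -exprD; apply/eqP.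
  rewrite (eq_prim_root_expr zP) -eq_expg_mod_order.
  by rewrite expgD -!dlE // groupM.
have z1 g : g \in C -> (z ^+ dl g == 1) = (g == 1%g).
  move=> gC; rewrite -[X in _ == X](expr0 z) (eq_prim_root_expr zP).
  by rewrite -eq_expg_mod_order expg0 -dlE.
pose b g s := z ^+ (dl g * dl s)%N.
have bC g s : b g s = b s g by rewrite /b mulnC.
have bMl s : {in C &, forall g g', b (g * g')%g s = b g s * b g' s}.
  by move=> g g' gC g'C; rewrite /b !exprM zM // exprMn.
have b1 s : b 1%g s = 1.
  by rewrite /b exprM (eqP (_ : z ^+ dl 1%g == 1)) ?expr1n // z1 ?group1.
have b0 g s : b g s != 0.
  by rewrite expf_neq0 // (prim_root_eq0 zP) -lt0n order_gt0.
have bVl s g : g \in C -> b g^-1%g s = (b g s)^-1.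
  move=> gC; apply: (mulIf (b0 g s)); rewrite mulVf //.
  by rewrite -bMl ?groupV // mulVg b1.
have b_sum g : g \in C -> \sum_(s in C) b g s = (g == 1%g)%:R * m.
  move=> gC; have [->|g1] := altP (g =P 1%g).
    under eq_bigr do rewrite b1.
    by rewrite sumr_const mul1r.
  rewrite mul0r; apply: (@sum_nontrivial_char _ _ C _ c0) => [s s' sC s'C||].
  - by rewrite !(bC g) bMl.
  - exact: cycle_id.
  rewrite /b mulnC exprM (_ : z ^+ dl c0 = z) ?z1 //.
  apply/eqP; rewrite -[X in _ == X](expr1 z) (eq_prim_root_expr zP).
  by rewrite -eq_expg_mod_order -dlE ?expg1 ?cycle_id.
pose c g s := if (g \in C) && (s \in C) then m^-1 * b g s else 0.
have cC g s : c g s = c s g by rewrite /c andbC bC.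
have c0l g s : g \notin C -> c g s = 0 by rewrite /c => /negPf->.
have orthr g g' t : \sum_s c g s * c g' (s^-1 * t)%g = (g == g')%:R * c g t.
  have [gC|gC] := boolP (g \in C); last first.
    by rewrite c0l // mulr0 big1 // => s _; rewrite c0l ?mul0r.
  have [g'C|g'C] := boolP (g' \in C); last first.
    rewrite big1 => [|s _]; last by rewrite [c g' _]c0l ?mulr0.
    by case: eqP => [gg'|_]; rewrite ?mul0r // -gg' gC in g'C *.
  have [tC|tC] := boolP (t \in C); last first.
    rewrite [c g t]cC [c t g]c0l // mulr0 big1 // => s _.
    have [sC|sC] := boolP (s \in C); last by rewrite cC c0l ?mul0r.
    by rewrite [c g' _]cC [X in _ * X]c0l ?mulr0 // groupMl ?groupV.
  (* Since b(g', s^-1 t) = b(g', t) / b(g', s), the sum reduces to character orthogonality for g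
     g'^-1. *)
  transitivity (\sum_(s in C) m^-1 * (m^-1 * b g' t) * b (g * g'^-1)%g s).
    rewrite [RHS]big_mkcond; apply: eq_bigr => s _; rewrite {1}/c gC /=.
    case: ifP => sC; last by rewrite mul0r.
    rewrite /c g'C groupMl ?groupV // tC /= bMl ?groupV // bVl //.
    rewrite !(bC g') bMl ?groupV // bVl //.
    ring.
  rewrite -mulr_sumr b_sum ?groupM ?groupV // -eq_mulgV1.
  case: eqP => [->|_]; last by rewrite !mul0r mulr0.
  by rewrite !mul1r /c g'C tC /= mulrAC mulVf // mul1r.
have sumr g : \sum_s c g s = (g == 1%g)%:R.
  have [gC|gC] := boolP (g \in C); last first.
    rewrite big1 => [|s _]; last exact: c0l.
    by case: eqP gC => // ->; rewrite group1.
  transitivity (\sum_(s in C) m^-1 * b g s).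
    by rewrite [RHS]big_mkcond; apply: eq_bigr => s _; rewrite /c gC.
  by rewrite -mulr_sumr b_sum // mulrCA mulVf // mulr1.
exists c; last first.
  move=> g; rewrite /c group1 andbT bC b1 mulr1.
  by case: (g \in C); rewrite ?mul1r ?mul0r.
split=> //.
- by move=> g s gZ; apply: c0l; apply: contra gZ => /CZ.
- by move=> g s sZ; rewrite cC; apply: c0l; apply: contra sZ => /CZ.
- move=> g s s'; under eq_bigr do rewrite mulrC !(cC _ s) (cC _ s').
  rewrite orthr eq_sym cC; case: eqP => [->|_] //; by rewrite !mul0r.
- by move=> s; under eq_bigr do rewrite cC; exact: sumr.
- move=> g s; rewrite /c !groupV; case: ifP => // /andP[gC sC].
  by rewrite bVl // [b g s^-1%g]bC bVl // bC.
Qed.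

Lemma nonstem_Lambda_not_normal :
  ~~ stem_group gT -> ~ is_normal (@Lambda k gT).
Proof.
move=> /(nonstem_pairing k_pchar0)[c0 c0Z [rho [rMl rMr r1l r1r [h rh]]]]
  [_ LN].
have [c cK cE] := cyclic_kernel c0Z.
have [x xE] := kernel_hopf_aut cK.
have [|||||||y my] := @monomial_build k gT 1%g 1%g rho;
  do ?by move=> *; rewrite ?perm1.
(* The row and column sums of [c] are deltas at 1, so u, v and r of [x] are trivial. *)
have Lx : Lambda x.
  have [c' [w [v [R sp]]]] := component_specP x.
  have rE g g' u : (g == u)%:R = (g == w u)%:R * R g' u.
    rewrite -(sum_coef_r sp); under eq_bigr do rewrite xE.
    rewrite (reindex_inj (mulIg g')) /=; under eq_bigr do rewrite mulgK.
    by rewrite (kernel_sumr cK) -eq_mulVg1 eq_sym.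
  have wR g u : w u = u /\ R g u = 1.
    have := rE u g u; rewrite eqxx; case: eqP => [<-|_] /esym.
      by rewrite mul1r.
    by rewrite mul0r => /esym/eqP; rewrite oner_eq0.
  apply/(Lambda_spec sp); split=> [u|g|g u]; try by have [] := wR g u.
    by have [] := wR 1%g u.
  have := sum_coef_l sp g 1%g (v g); rewrite eqxx (spec_R1r sp) mulr1.
  under eq_bigr do rewrite xE invg1 mul1g.
  rewrite (kernel_suml cK) -eq_mulgV1; case: eqP => // _ /esym/eqP.
  by rewrite oner_eq0.
have := LN x y Lx; set a := (x ^ y)%g => La.
have e : (y * a = x * y)%g by rewrite /a /conjg mulKVg.
have [c' [w [v [R sp]]]] := component_specP a.
have [w1 v1 R1] := (Lambda_spec sp).1 La.
(* Membership in Lambda(G) makes the coefficient of e_1 # h in a(epsilon # h) equal to 1; the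
   computation below gives 0. *)
have := sum_coef_l sp h 1%g h; rewrite v1 R1 eqxx mulr1 => E.
suff S0 : \sum_g coef a g h 1%g h = 0.
  by move/eqP: E; rewrite S0 eq_sym oner_eq0.
have aE g : coef a g h 1%g h = rho g h * c g 1%g.
  (* As rho(1, t) = 1, applying [y] does not change coefficients at e_1 # t, so [a] may be replaced
     by y a = x y. *)
  have yE X t : dcoef (y X) 1%g t = dcoef X 1%g t.
    rewrite dcoef_lfun.
    transitivity (\sum_u (u == 1%g)%:R * \sum_s (s == t)%:R *
      (rho u s * dcoef X u s)).
      apply: eq_bigr => u _; rewrite mulr_sumr; apply: eq_bigr => s _.
      rewrite (monomial_coef _ _ _ _ my) !perm1 -mulnb natrM.
      rewrite [1%g == u]eq_sym [t == s]eq_sym; ring.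
    by rewrite !sum_deltal r1l mul1r.
  rewrite {1}/coef -yE -mul_hopf_autE e mul_hopf_autE my !perm1 linearZ_LR
    dcoefZ.
  by rewrite -/(coef _ _ _ _ _) xE invg1 mul1g mulgV.
under eq_bigr do rewrite aE cE.
transitivity (\sum_(g in <[c0]>%G) rho g h / #[c0]%g%:R).
  rewrite [RHS]big_mkcond; apply: eq_bigr => g _.
  by case: (g \in _); rewrite ?mul1r // mul0r mulr0.
by rewrite -mulr_suml (@sum_nontrivial_char _ _ _ _ c0) ?mul0r ?cycle_id //.
Qed.

End NonStem.

Theorem theorem7p1 (k : closedFieldType) (hk : [pchar k]%R =i pred0)
    (gT : finGroupType) :
  [/\ is_normal (@Lambda k gT) <-> stem_group gT,
      internal_sdprod (@K_aut k gT) (@Hom_G_Ghat k gT) (@SpAut_c k gT)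
    & internal_sdprod (fun _ => True) (@Lambda k gT) (@K_aut k gT)
        <-> stem_group gT].
Proof.
have stemP : is_normal (@Lambda k gT) -> stem_group gT.
  by move=> LN; apply: contraT => /(nonstem_Lambda_not_normal hk)/(_ LN).
split.
- by split; [exact: stemP | exact: stem_Lambda_normal].
- exact: K_aut_sdprod.
split; last exact: stem_sdprod.
case=> Lsub _ LN _ _; apply: stemP; split=> // x y Lx.
exact: LN.
Qed.
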